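(* For each integer $k\ge2$ there exists a constant $c_k>0$ such that the following holds for every power $q$ of an odd prime. Let $E\subset\mathbb{F}_q^d$ be such that $|E|>c_k\,q^{\frac{d+1}{2}}$. Then: (a) if $d=2$ and $k\ge3$, then $\Delta_{C_{2k}}(E)\supset\mathbb{F}_q\setminus\{0\}$; (b) if $d\ge3$ and $k\ge2$, then $\Delta_{C_{2k}}(E)\supset\mathbb{F}_q\setminus\{0\}$.
   Context: Graphs are simple and undirected; subgraphs need not be induced. For $n\ge3$, $C_n$ is the cycle graph with vertex set $\{1,\dots,n\}$ and adjacency $1\sim2\sim\cdots\sim n\sim1$. $\mathbb{F}_q$ is the field with $q$ elements, $q$ a power of an odd prime. For $x\in\mathbb{F}_q^d$ put $\|x\|=x_1^2+\cdots+x_d^2\in\mathbb{F}_q$. For $E\subset\mathbb{F}_q^d$ and $t\in\mathbb{F}_q$, the $t$-distance graph $\mathcal{G}_t(E)$ has vertex set $E$, with $x\sim y$ if and only if $\|x-y\|=t$. For a finite graph $G$, the $G$-distance set is $\Delta_G(E)=\{t\in\mathbb{F}_q:\mathcal{G}_t(E)\text{ contains a subgraph isomorphic to }G\}$. The constant $c_k$ depends only on $k$ (not on $q$, $d$ or $E$). *)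

(* Defs.v *)
From HB Require Import structures.
From mathcomp Require Import all_boot all_order all_algebra.
From mathcomp Require Import all_classical all_reals all_analysis.

Set Implicit Arguments.
Unset Strict Implicit.
Unset Printing Implicit Defensive.

Import Order.TTheory GRing.Theory Num.Theory.

Local Open Scope ring_scope.

Record sgraph := SGraph {
  svertex :> finType;
  sedge : rel svertex;
  sedge_sym : symmetric sedge;
  sedge_irr : irreflexive sedge }.

(* Not necessarily induced: any symmetric set of edges of [G] between the
   selected vertices is allowed. *)
Record subgraph (G : sgraph) := Subgraph {
  sub_vertex : {set G};
  sub_edge : rel G;
  sub_edge_sym : symmetric sub_edge;
  sub_edge_incl : forall x y, sub_edge x y ->
    [&& x \in sub_vertex, y \in sub_vertex & sedge x y] }.

Section GraphOfSubgraph.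
Variables (G : sgraph) (K : subgraph G).

Definition subgraph_rel : rel {x : G | x \in sub_vertex K} :=
  fun x y => sub_edge K (val x) (val y).

Lemma subgraph_rel_sym : symmetric subgraph_rel.
Proof. by move=> x y; exact: sub_edge_sym. Qed.

Lemma subgraph_rel_irr : irreflexive subgraph_rel.
Proof.
move=> x; apply/negP => /sub_edge_incl /and3P[_ _].
by rewrite sedge_irr.
Qed.

Definition graph_of_subgraph : sgraph :=
  SGraph subgraph_rel_sym subgraph_rel_irr.

End GraphOfSubgraph.

Definition isomorphic (G H : sgraph) : Prop :=
  exists f : G -> H,
    bijective f /\ forall x y : G, sedge (f x) (f y) = sedge x y.

Definition contains_copy (G H : sgraph) : Prop :=
  exists K : subgraph G, isomorphic (graph_of_subgraph K) H.

Section Cycle.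
Variable n : nat.

(* Vertices are numbered from 0, and [ordS] is the successor modulo [n].  The
   condition [i != j] is redundant for [2 <= n]; it only excludes a loop when
   [n = 1]. *)
Definition cycle_rel : rel 'I_n :=
  fun i j => (i != j) && ((j == ordS i) || (i == ordS j)).

Lemma cycle_rel_sym : symmetric cycle_rel.
Proof. by move=> i j; rewrite /cycle_rel eq_sym orbC. Qed.

Lemma cycle_rel_irr : irreflexive cycle_rel.
Proof. by move=> i; rewrite /cycle_rel eqxx. Qed.

Definition cycle_graph : sgraph := SGraph cycle_rel_sym cycle_rel_irr.

End Cycle.

Definition sqnorm (F : finFieldType) (d : nat) (x : 'rV[F]_d) : F :=
  \sum_(i < d) x 0 i ^+ 2.

Section DistanceGraph.
Variables (F : finFieldType) (d : nat) (t : F) (E : {set 'rV[F]_d}).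

(* The condition [x != y] is redundant for [t != 0]; for [t = 0] it keeps the
   graph simple, as [sqnorm (x - x) = 0]. *)
Definition distance_rel : rel {x : 'rV[F]_d | x \in E} :=
  fun x y => (x != y) && (sqnorm (val x - val y) == t).

Lemma distance_rel_sym : symmetric distance_rel.
Proof.
move=> x y; rewrite /distance_rel eq_sym; congr (_ && (_ == _)).
by apply: eq_bigr => i _; rewrite -opprB mxE sqrrN.
Qed.

Lemma distance_rel_irr : irreflexive distance_rel.
Proof. by move=> x; rewrite /distance_rel eqxx. Qed.

Definition distance_graph : sgraph :=
  SGraph distance_rel_sym distance_rel_irr.

End DistanceGraph.

Definition graph_distance_set (G : sgraph) (F : finFieldType) (d : nat)
    (E : {set 'rV[F]_d}) : set F :=
  [set t : F | contains_copy (distance_graph t E) G]%classic.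

(* Main.v *)
Require Import Defs.
From HB Require Import structures.
From mathcomp Require Import all_boot all_order all_algebra all_field.
From mathcomp Require Import zify ring lra.
From mathcomp Require Import all_classical all_reals all_analysis.

Set Implicit Arguments.
Unset Strict Implicit.
Unset Printing Implicit Defensive.

Import Order.TTheory GRing.Theory Num.Theory.

Local Open Scope ring_scope.

(** Two facts combine.  Pseudorandomness: for [t != 0] the number [N] of pairs
    of [A * B] at distance [t] satisfies
    [(q N - |A||B|)^2 <= 9 q^(d+1) |A||B|].  Extremal graph theory: an almost
    regular graph on [n] vertices of average degree much larger than [n^(1/k)]
    contains a [2k]-cycle.  Deleting the few points of [E] of abnormally large
    degree leaves an almost regular graph of degree about [n / q], and
    [n / q >> n^(1/k)] follows from [(d+1)(k-1) >= 2k], which for [d, k >= 2]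
    fails only when [d = k = 2].

    The graph theory counts closed walks.  For the adjacency matrix [M] of a
    graph of maximal degree [Delta], a closed [2k]-walk that visits [x] twice
    splits there into two closed walks, and [j |-> (M^(2j))_xx] being
    log-convex bounds the number of such pairs by [Delta (M^(2k-2))_xx].
    So degenerate walks number at most [4k^2 Delta tr M^(2k-2)], which is
    smaller than [tr M^(2k)].

    Pseudorandomness is Fourier analysis; the eigenvalues that occur are
    Kloosterman sums for even [d] and Salie sums for odd [d].  Salie sums are
    elementary.  For Kloosterman sums [K], Stepanov's method gives the bound
    [|K| <= 4 p sqrt q] over a field of [q = p^(2m)] elements, with the
    superfluous factor [2p].  It is removed by the relation
    [K_F(a,b)^2 + K_L(a,b) = 2q] for [L] quadratic over [F], [|F| = q], which
    would amplify any violation of [|K_F| <= 2 sqrt q] without limit along a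
    tower of quadratic extensions. *)

(** * Even cycles in almost regular graphs *)

(** Lagrange's identity writes twice the defect as a sum of squares. The realness hypotheses let the
    inequality serve both real fields and [algC]. *)
Lemma sum_mul_sqr_le (R : numDomainType) (I : finType) (f g : I -> R) :
    (forall i, f i \is Num.real) -> (forall i, g i \is Num.real) ->
  (\sum_i f i * g i) ^+ 2 <= (\sum_i f i ^+ 2) * (\sum_i g i ^+ 2).
Proof.
move=> fR gR; rewrite -subr_ge0 -(pmulrn_lge0 _ (isT : (0 < 2)%N)).
set D := (_ - _).
suff -> : D *+ 2 = \sum_i \sum_j (f i * g j - f j * g i) ^+ 2.
  apply: sumr_ge0 => i _; apply: sumr_ge0 => j _.
  by apply: real_exprn_even_ge0 => //; rewrite rpredB ?rpredM.
have E i j : (f i * g j - f j * g i) ^+ 2 =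
    f i ^+ 2 * g j ^+ 2 + f j ^+ 2 * g i ^+ 2 - (f i * g i) * (f j * g j) *+ 2.
  by ring.
under [RHS]eq_bigr do under eq_bigr do rewrite E.
under eq_bigr do rewrite sumrB big_split /= -mulr_sumr -mulr_suml sumrMnl -mulr_sumr.
rewrite sumrB big_split /= -mulr_suml -mulr_sumr sumrMnl -mulr_suml /D; ring.
Qed.

Lemma natr_cardE (R : pzSemiRingType) (T : finType) (P : pred T) :
  #|[set x | P x]|%:R = \sum_x (P x)%:R :> R.
Proof.
rewrite -sum1_card natr_sum big_mkcond; apply: eq_bigr => x _.
by rewrite inE; case: (P x).
Qed.

(** * Log-convex sequences *)

Section LogConvex.
Variables (R : realFieldType) (u : nat -> R).
Hypothesis u_ge0 : forall j, 0 <= u j.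
Hypothesis u_logconvex : forall j, u j.+1 ^+ 2 <= u j * u j.+2.

(** The ratios [u j.+1 / u j] do not decrease; the cross-multiplied form also makes sense when terms
    vanish. *)
Lemma logconvex_shift1 a b : (a <= b)%N -> u a.+1 * u b <= u a * u b.+1.
Proof.
move=> /subnK <-; elim: (b - a)%N => [|j IHj]; first by rewrite mulrC.
rewrite addSn; set c := (j + a)%N in IHj *.
have := u_ge0 c.+1; rewrite le_eqVlt => /orP[/eqP <-|c1_gt0].
  by rewrite mulr0 mulr_ge0.
have c_gt0 : 0 < u c.
  rewrite lt_neqAle u_ge0 andbT; apply/eqP => c0.
  by have := u_logconvex c; rewrite -c0 mul0r leNgt exprn_gt0.
rewrite -(ler_pM2r c_gt0).
apply: (@le_trans _ _ (u a * u c.+1 ^+ 2)).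
  by rewrite expr2 mulrAC mulrA ler_wpM2r // ltW.
by rewrite -mulrA ler_wpM2l // mulrC.
Qed.

Lemma logconvex_shift i a b :
  (a + i <= b)%N -> u (a + i)%N * u b <= u a * u (b + i)%N.
Proof.
elim: i b => [|i IHi] b; first by rewrite !addn0.
rewrite addnS => ai_b; apply: le_trans (logconvex_shift1 (ltnW ai_b)) _.
by rewrite addnS -addSn IHi // (leq_trans (ltnW ai_b)).
Qed.

Lemma logconvex_mul_le a b : u a.+1 * u b.+1 <= u 1 * u (a + b).+1.
Proof.
wlog ab : a b / (a <= b)%N => [hw|].
  by case/orP: (leq_total a b) => /hw //; rewrite mulrC addnC.
have := @logconvex_shift a 1 b.+1; rewrite add1n addSn (addnC b); exact.
Qed.

(** Interpolation of [m] between [0] and [m.+1], with the roots cleared. *)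
Lemma logconvex_pow_pred m : u m ^+ m.+1 <= u 0 * u m.+1 ^+ m.
Proof.
elim: m => [|m IHm]; first by rewrite expr1 expr0 mulr1.
have := u_ge0 m.+1; rewrite le_eqVlt => /orP[/eqP <-|m1_gt0].
  by rewrite expr0n mulr_ge0 ?exprn_ge0.
rewrite -(ler_pM2r (exprn_gt0 m m1_gt0)) -exprD.
have -> : (m.+2 + m = 2 * m.+1)%N by lia.
rewrite exprM.
apply: le_trans (lerXn2r _ _ _ (u_logconvex m)) _.
- by rewrite nnegrE sqr_ge0.
- by rewrite nnegrE mulr_ge0.
by rewrite exprMn mulrAC ler_wpM2r ?exprn_ge0.
Qed.

Lemma logconvex_pow1 j : u 1 ^+ j.+1 <= u 0 ^+ j * u j.+1.
Proof.
elim: j => [|j IHj]; first by rewrite expr1 expr0 mul1r.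
rewrite exprS; apply: le_trans (ler_wpM2l (u_ge0 1) IHj) _.
rewrite mulrCA exprSr -mulrA ler_wpM2l ?exprn_ge0 //.
exact: logconvex_shift1.
Qed.

End LogConvex.

(** * Walks in a graph and powers of the adjacency matrix *)

Section Walks.
Variables (R : realFieldType) (V : finType) (e : rel V).
Hypothesis e_sym : symmetric e.
Hypothesis e_irr : irreflexive e.

(** The entries of the [n]-th power of the adjacency matrix. *)
Fixpoint walks n x y : R :=
  if n is m.+1 then \sum_z (e x z)%:R * walks m z y else (x == y)%:R.

Definition degree x : R := \sum_y (e x y)%:R.

Lemma walks_ge0 n x y : 0 <= walks n x y.
Proof.
by elim: n x => [|n IHn] x //=; apply: sumr_ge0 => z _; rewrite mulr_ge0.
Qed.

Lemma walksD a b x y : walks (a + b) x y = \sum_z walks a x z * walks b z y.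
Proof.
elim: a x => [|a IHa] x /=.
  rewrite (bigD1 x) //= eqxx mul1r big1 ?addr0 // => z /negPf.
  by rewrite eq_sym => ->; rewrite mul0r.
under eq_bigr do rewrite IHa mulr_sumr.
rewrite exchange_big; apply: eq_bigr => z _; rewrite mulr_suml.
by apply: eq_bigr => t _; rewrite mulrA.
Qed.

Lemma walks1 x y : walks 1 x y = (e x y)%:R.
Proof.
rewrite /= (bigD1 y) //= eqxx mulr1 big1 ?addr0 // => z /negPf ->.
by rewrite mulr0.
Qed.

Lemma walks_sym n x y : walks n x y = walks n y x.
Proof.
elim: n x y => [|n IHn] x y; first by rewrite /= eq_sym.
rewrite -[in RHS]addn1 walksD /=; apply: eq_bigr => z _.
by have := walks1 z x; rewrite /= => ->; rewrite mulrC e_sym IHn.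
Qed.

Lemma walks_diagD a b x : walks (a + b) x x = \sum_z walks a x z * walks b x z.
Proof. by rewrite walksD; apply: eq_bigr => z _; rewrite (walks_sym b). Qed.

Lemma walks_diag2 x : walks 2 x x = degree x.
Proof.
rewrite -[2%N]/(1 + 1)%N walks_diagD; apply: eq_bigr => z _.
by rewrite walks1; case: (e x z); rewrite ?mulr1 ?mulr0.
Qed.

Lemma walks_diag_sqr_le a b x :
  walks (a + b) x x ^+ 2 <= walks (a + a) x x * walks (b + b) x x.
Proof.
rewrite !walks_diagD; apply: sum_mul_sqr_le => z; exact: num_real.
Qed.

Lemma walks_diag_logconvex x j :
  walks (j.+1).*2 x x ^+ 2 <= walks j.*2 x x * walks (j.+2).*2 x x.
Proof.
have := walks_diag_sqr_le j j.+2 x.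
by rewrite !addnn -addSnnS addnn.
Qed.

Definition trace_walks n : R := \sum_x walks n x x.

(** Cauchy-Schwarz over pairs of vertices: by symmetry, the trace of a product of two powers is an
    inner product of matrices. *)
Lemma trace_walks_logconvex j :
  trace_walks (j.+1).*2 ^+ 2 <= trace_walks j.*2 * trace_walks (j.+2).*2.
Proof.
have E a b : trace_walks (a + b) =
    \sum_(p : V * V) walks a p.1 p.2 * walks b p.1 p.2.
  by rewrite -[RHS](pair_bigA _ (fun x y => walks a x y * walks b x y));
     apply: eq_bigr => x _; rewrite walks_diagD.
have -> : (j.+1).*2 = (j + j.+2)%N by rewrite -addSnnS addnn.
rewrite -!addnn !E; apply: sum_mul_sqr_le => z; exact: num_real.
Qed.

Definition total_walks n : R := \sum_x \sum_y walks n x y.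

Lemma total_walksD a b :
  total_walks (a + b) = \sum_z (\sum_x walks a z x) * (\sum_y walks b z y).
Proof.
rewrite /total_walks.
under eq_bigr do under eq_bigr do rewrite walksD.
under eq_bigr do rewrite exchange_big /=.
rewrite exchange_big; apply: eq_bigr => z _; rewrite mulr_suml.
apply: eq_bigr => x _; rewrite mulr_sumr.
by apply: eq_bigr => y _; rewrite (walks_sym a).
Qed.

Lemma total_walks_logconvex j :
  total_walks (j.+1).*2 ^+ 2 <= total_walks j.*2 * total_walks (j.+2).*2.
Proof.
have -> : (j.+1).*2 = (j + j.+2)%N by rewrite -addSnnS addnn.
rewrite -!addnn !total_walksD; apply: sum_mul_sqr_le => z; exact: num_real.
Qed.

Lemma trace_walks_ge0 n : 0 <= trace_walks n.
Proof. by apply: sumr_ge0 => x _; exact: walks_ge0. Qed.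

Lemma total_walks_ge0 n : 0 <= total_walks n.
Proof. by do 2![apply: sumr_ge0 => ? _]; exact: walks_ge0. Qed.

Lemma trace_walks0 : trace_walks 0 = #|V|%:R.
Proof.
by rewrite /trace_walks /=; under eq_bigr do rewrite eqxx; rewrite sumr_const.
Qed.

Lemma total_walks0 : total_walks 0 = #|V|%:R.
Proof.
rewrite /total_walks -trace_walks0; apply: eq_bigr => x _ /=.
by rewrite (bigD1 x) //= big1 ?addr0 // => z /negPf; rewrite eq_sym => ->.
Qed.

(** The square of a row sum is at most [#|V|] times the sum of the squared entries, which for the
    [j]-th power is a diagonal entry of the [2j]-th. *)
Lemma total_walks_le_trace j :
  total_walks j.*2 <= #|V|%:R * trace_walks j.*2.
Proof.
rewrite -addnn total_walksD /trace_walks mulr_sumr; apply: ler_sum => x _.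
rewrite walks_diagD -expr2.
have := @sum_mul_sqr_le R V (fun=> 1) (walks j x)
  (fun=> num_real _) (fun=> num_real _).
under eq_bigr do rewrite mul1r.
by under [X in _ <= X * _]eq_bigr do rewrite expr1n; rewrite sumr_const.
Qed.

(** The spectral reason is that the largest eigenvalue is at least the average degree. Without
    eigenvalues: [total_walks 2] is at least [#|V| * D ^+ 2] by Cauchy-Schwarz, log-convexity passes
    to length [2k], and [total_walks_le_trace] passes to the trace. *)
Lemma trace_walks_lower (D : R) (k : nat) :
    (0 < #|V|)%N -> 0 <= D -> #|V|%:R * D <= \sum_x degree x -> (0 < k)%N ->
  D ^+ k.*2 <= trace_walks k.*2.
Proof.
move=> V_gt0 D_ge0 avgD; case: k => // k _.
set n : R := #|V|%:R; have n_gt0 : 0 < n by rewrite ltr0n.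
have tw2 : n * D ^+ 2 <= total_walks 2.
  rewrite -(ler_pM2l n_gt0).
  have -> : n * (n * D ^+ 2) = (n * D) ^+ 2 by rewrite exprMn mulrA.
  apply: (@le_trans _ _ ((\sum_x degree x) ^+ 2)).
    by rewrite lerXn2r ?nnegrE ?sumr_ge0 ?mulr_ge0 ?ler0n // => x _;
       rewrite sumr_ge0.
  have := @sum_mul_sqr_le R V (fun=> 1) degree
    (fun=> num_real _) (fun=> num_real _).
  under eq_bigr do rewrite mul1r.
  under [X in _ <= X * _]eq_bigr do rewrite expr1n.
  rewrite sumr_const => /le_trans; apply.
  rewrite ler_wpM2l ?ler0n // -[2%N]/(1 + 1)%N total_walksD.
  apply: ler_sum => x _; rewrite -expr2.
  by under [in leRHS]eq_bigr do rewrite walks1.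
have lc := @logconvex_pow1 R (fun j => total_walks j.*2)
  (fun=> total_walks_ge0 _) total_walks_logconvex k.
rewrite /= total_walks0 -/n in lc.
rewrite -(ler_pM2l (exprn_gt0 k.+1 n_gt0)).
apply: (@le_trans _ _ (total_walks 2 ^+ k.+1)).
  rewrite -mul2n exprM -exprMn lerXn2r ?nnegrE ?total_walks_ge0 //.
  by rewrite mulr_ge0 ?exprn_ge0 // ltW.
apply: le_trans lc _; rewrite exprSr -mulrA ler_wpM2l ?exprn_ge0 ?(ltW n_gt0) //.
exact: total_walks_le_trace.
Qed.

Lemma trace_walks_upper k :
  trace_walks k.*2 ^+ k.+1 <= #|V|%:R * trace_walks k.+1.*2 ^+ k.
Proof.
rewrite -trace_walks0.
exact: (@logconvex_pow_pred R (fun j => trace_walks j.*2)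
  (fun=> trace_walks_ge0 _) trace_walks_logconvex k).
Qed.

Lemma walks_diag_mul_even a b x :
  walks a.+1.*2 x x * walks b.+1.*2 x x <= degree x * walks (a + b).+1.*2 x x.
Proof.
rewrite -walks_diag2.
exact: (@logconvex_mul_le R (fun j => walks j.*2 x x)
  (fun=> walks_ge0 _ _ _) (walks_diag_logconvex x) a b).
Qed.

(* An odd return count is at most the geometric mean of its two even
   neighbours, which reduces the odd case to the even one. *)
Lemma walks_diag_mul l m k x : (1 < l)%N -> (1 < m)%N -> (l + m = k.+1.*2)%N ->
  walks l x x * walks m x x <= degree x * walks k.*2 x x.
Proof.
move=> l_gt1 m_gt1 lmk.
have deg_ge0 : 0 <= degree x by rewrite -walks_diag2 walks_ge0.
have even a b : (a.+1 + b.+1 = k.+1)%N ->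
    walks a.+1.*2 x x * walks b.+1.*2 x x <= degree x * walks k.*2 x x.
  by move=> abk; have := walks_diag_mul_even a b x; rewrite (_ : (a + b).+1 = k) //; lia.
case: (boolP (odd l)) => l_odd; last first.
  have [a la] : exists a, l = a.+1.*2 by exists l./2.-1; lia.
  have [b mb] : exists b, m = b.+1.*2 by exists m./2.-1; lia.
  by rewrite la mb; apply: even; lia.
have [a la] : exists a, l = (a.+1 + a.+2)%N by exists l./2.-1; lia.
have [b mb] : exists b, m = (b.+2 + b.+1)%N by exists m./2.-1; lia.
rewrite -(@ler_pXn2r _ 2) ?nnegrE ?mulr_ge0 ?walks_ge0 //.
rewrite exprMn [leRHS]expr2 la mb.
apply: le_trans (ler_pM (sqr_ge0 _) (sqr_ge0 _) (walks_diag_sqr_le _ _ x)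
  (walks_diag_sqr_le _ _ x)) _.
rewrite mulrACA !addnn.
by apply: ler_pM; rewrite ?mulr_ge0 ?walks_ge0 //; apply: even; lia.
Qed.

(** Here [t] lists the [n] interior vertices, whence the length [n.+1]. *)
Lemma card_walks n x y :
  #|[set t : n.-tuple V | path e x (rcons t y)]|%:R = walks n.+1 x y.
Proof.
elim: n x => [|n IHn] x.
  rewrite walks1; case exy: (e x y).
    rewrite (_ : [set t | _] = [set [tuple]]) ?cards1 //.
    by apply/finset.setP => t; rewrite !inE tuple0 /= exy eqxx.
  rewrite (_ : [set t | _] = finset.set0) ?cards0 //.
  by apply/finset.setP => t; rewrite !inE tuple0 /= exy.
have -> : walks n.+2 x y = \sum_z (e x z)%:R * walks n.+1 z y by [].
transitivity (\sum_z \sum_(t : n.-tuple V) (e x z && path e z (rcons t y))%:R : R).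
  rewrite pair_big /= natr_cardE.
  rewrite (reindex (fun p : V * n.-tuple V => [tuple of p.1 :: p.2])) /=; last first.
    exists (fun t : n.+1.-tuple V => (thead t, [tuple of behead t])) => [[z t] _|t _] /=.
      by congr (_, _); apply: val_inj.
    by apply: val_inj => /=; case/tupleP: t.
  by apply: eq_bigr => -[z t] _.
apply: eq_bigr => z _; rewrite -IHn.
rewrite natr_cardE mulr_sumr; apply: eq_bigr => t _.
by rewrite -natrM mulnb.
Qed.

(** * Closed walks that repeat a vertex *)

Definition closed_walks n : {set n.-tuple V} := [set t : n.-tuple V | cycle e t].

(** An equality of the entries at positions [0] and [l.+1] splits the cyclic sequence into closed
    walks of lengths [l.+1] and [m.+1] from a common vertex. *)
Definition pinched_walks l m : {set (l.+1 + m.+1).-tuple V} :=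
  [set t in closed_walks _ | tnth t (lshift _ ord0) == tnth t (rshift _ ord0)].

Lemma card_closed_walks n : #|closed_walks n.+1|%:R = trace_walks n.+1.
Proof.
rewrite natr_cardE /trace_walks.
rewrite (reindex (fun p : V * n.-tuple V => [tuple of p.1 :: p.2])) /=; last first.
  exists (fun t : n.+1.-tuple V => (thead t, [tuple of behead t])) => [[z t] _|t _] /=.
    by congr (_, _); apply: val_inj.
  by apply: val_inj => /=; case/tupleP: t.
rewrite -(pair_bigA _ (fun x (t : n.-tuple V) => (cycle e (x :: t))%:R)) /=.
by apply: eq_bigr => x _; rewrite -natr_cardE; have := card_walks n x x.
Qed.

Lemma card_pinched_walks l m :
  #|pinched_walks l m|%:R = \sum_x walks l.+1 x x * walks m.+1 x x.
Proof.
pose T := (V * (l.-tuple V * m.-tuple V))%type.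
pose h (p : T) := [tuple of (p.1 :: p.2.1) ++ (p.1 :: p.2.2)].
transitivity (\sum_(p : T)
    (path e p.1 (rcons p.2.1 p.1) && path e p.1 (rcons p.2.2 p.1))%:R : R).
  rewrite -sum1_card natr_sum (reindex h) /=; last first.
    exists (fun t : (l.+1 + m.+1).-tuple V => (thead t, ([tuple tnth t (lshift _ (lift ord0 i)) | i < l],
                      [tuple tnth t (rshift l.+1 (lift ord0 i)) | i < m]))).
      move=> [x [s1 s2]] _ /=; congr (_, (_, _)).
      - by apply: eq_from_tnth => i; rewrite tnth_mktuple tnth_lshift; rewrite !(tnth_nth x).
      - by apply: eq_from_tnth => i; rewrite tnth_mktuple tnth_rshift !(tnth_nth x).
    move=> t; rewrite inE inE => /andP[_ /eqP tE]; apply: eq_from_tnth => i.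
    rewrite -(fintype.splitK i); case: (fintype.split i) => j /=.
      rewrite tnth_lshift; case: (unliftP ord0 j) => [j' ->|->].
        by rewrite -[RHS](tnth_mktuple (fun j' => tnth t (lshift m.+1 (lift ord0 j')))) !(tnth_nth (thead t)).
      by rewrite (tnth_nth (thead t)) /thead; congr tnth; apply: val_inj.
    rewrite tnth_rshift; case: (unliftP ord0 j) => [j' ->|->].
      by rewrite -[RHS](tnth_mktuple (fun j' => tnth t (rshift l.+1 (lift ord0 j')))) !(tnth_nth (thead t)).
    by rewrite -tE (tnth_nth (thead t)) /thead; congr tnth; apply: val_inj.
  rewrite big_mkcond; apply: eq_bigr => -[x [s1 s2]] _.
  rewrite !inE tnth_lshift tnth_rshift !(tnth_nth x) /= eqxx andbT.
  rewrite rcons_cat /= -cat_rcons cat_path last_rcons.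
  by case: (_ && _).
rewrite -(pair_bigA _ (fun x (s : l.-tuple V * m.-tuple V) =>
  (path e x (rcons s.1 x) && path e x (rcons s.2 x))%:R)) /=.
apply: eq_bigr => x _.
rewrite -(pair_bigA _ (fun (s1 : l.-tuple V) (s2 : m.-tuple V) =>
  (path e x (rcons s1 x) && path e x (rcons s2 x))%:R)) /=.
have := card_walks l x x; have := card_walks m x x; rewrite /= => <- <-.
rewrite !natr_cardE mulr_suml.
apply: eq_bigr => s1 _; rewrite mulr_sumr; apply: eq_bigr => s2 _.
by rewrite -natrM mulnb.
Qed.

Lemma pinched_walks_le (Delta : R) (x0 : V) k N l :
    (forall x, degree x <= Delta) -> N = k.+1.*2 -> (0 < l < N)%N ->
  #|[set t : N.-tuple V | cycle e t && (nth x0 t 0 == nth x0 t l)]|%:R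
    <= Delta * trace_walks k.*2.
Proof.
case: l => // l degD NE /= lN.
have [m NE2] : exists m, N = (l.+1 + m.+1)%N by exists (N - l.+2)%N; lia.
rewrite {}NE2 in NE lN *; rewrite (_ : [set t | _] = pinched_walks l m); last first.
  apply/finset.setP => t; rewrite !inE !(tnth_nth x0) /=.
  by rewrite addn0.
rewrite card_pinched_walks mulr_sumr; apply: ler_sum => x _.
have RHS_ge0 : 0 <= Delta * walks k.*2 x x.
  rewrite mulr_ge0 ?walks_ge0 //; apply: le_trans (degD x).
  by rewrite -walks_diag2 walks_ge0.
(* A closed walk of length 1 would be a loop; once this is excluded on both sides, both lengths
   exceed 1 and [walks_diag_mul] applies. *)
case: l NE lN => [|l] NE lN; first by rewrite walks1 e_irr mul0r.
case: m NE lN => [|m] NE lN; first by rewrite walks1 e_irr mulr0.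
apply: le_trans (walks_diag_mul _ _ _ NE) _ => //.
by rewrite ler_wpM2r ?walks_ge0.
Qed.

(** Rotating the walk by [i] moves the coincidence to positions [0] and [j - i]. *)
Lemma collision_walks_le (Delta : R) (x0 : V) k (i j : nat) :
    (forall x, degree x <= Delta) -> (i < j < k.+1.*2)%N ->
  #|[set t : (k.+1.*2).-tuple V | cycle e t && (nth x0 t i == nth x0 t j)]|%:R
    <= Delta * trace_walks k.*2.
Proof.
move=> degD /andP[ij jN].
have lN : (0 < j - i < k.+1.*2)%N by lia.
apply: le_trans (pinched_walks_le x0 degD (erefl _) lN).
rewrite ler_nat -(card_imset _ (_ : injective (fun t : (k.+1.*2).-tuple V => rot_tuple i t))).
  apply/subset_leq_card/fintype.subsetP => _ /imsetP[t + ->].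
  rewrite !inE rot_cycle => /andP[-> /eqP tij] /=.
  have iN : (i < k.+1.*2)%N by lia.
  rewrite /rot !nth_cat !nth_drop size_drop size_tuple subn_gt0 iN.
  by rewrite ltn_sub2r // addn0 subnKC ?(ltnW ij) ?tij.
by move=> t1 t2 /(congr1 val) /= /rot_inj /val_inj.
Qed.

(** Without a cycle every closed walk of length [2k] repeats a vertex, so a union bound over pairs
    of positions gives [tr M^(2k) <= 4 k^2 Delta tr M^(2k-2)]. By [trace_walks_upper] this becomes
    [tr M^(2k) <= (4 k^2 Delta)^k #|V|], against [trace_walks_lower]. *)
Theorem even_cycle_of_dense (D Delta : R) k :
    (0 < #|V|)%N -> 0 <= D -> (forall x, degree x <= Delta) ->
    #|V|%:R * D <= \sum_x degree x ->
    (1 < k)%N -> ((k.*2 ^ 2)%:R * Delta) ^+ k * #|V|%:R < D ^+ k.*2 ->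
  exists t : k.*2.-tuple V, uniq t && cycle e t.
Proof.
case: k => [|k] // V_gt0 D_ge0 degD avgD k_gt0 ltD.
have /card_gt0P[x0 _] := V_gt0.
apply/existsP; apply: contraLR ltD; rewrite negb_exists => /forallP noC.
set N := k.+1.*2 in noC *.
rewrite -leNgt; apply: le_trans (trace_walks_lower V_gt0 D_ge0 avgD _) _ => //.
set T := trace_walks _.
have Delta_ge0 : 0 <= Delta.
  by apply: le_trans (degD x0); rewrite -walks_diag2 walks_ge0.
have T_le : T <= (N ^ 2)%:R * Delta * trace_walks k.*2.
  rewrite /T doubleS -card_closed_walks -doubleS -/N natr_cardE.
  apply: (@le_trans _ _ (\sum_(t : N.-tuple V) \sum_(p : 'I_N * 'I_N)
    ((p.1 < p.2)%N && (cycle e t && (nth x0 t p.1 == nth x0 t p.2)))%:R)).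
    apply: ler_sum => t _; case: (boolP (cycle e t)) => [ct|_]; last first.
      by apply: sumr_ge0 => p _; rewrite ler0n.
    have := noC t; rewrite ct andbT => /(uniqPn x0)[i [j [ij]]].
    rewrite size_tuple => jN tij.
    rewrite (bigD1 (Ordinal (ltn_trans ij jN), Ordinal jN)) //= ij tij eqxx.
    by rewrite lerDl sumr_ge0.
  rewrite exchange_big /= -mulrA.
  apply: (@le_trans _ _ (\sum_(p : 'I_N * 'I_N) (Delta * trace_walks k.*2))).
    apply: ler_sum => -[i j] _ /=; case: (ltnP i j) => ij /=; last first.
      by rewrite big1 // mulr_ge0 ?trace_walks_ge0.
    by rewrite -natr_cardE; apply: collision_walks_le; rewrite ?ij ?ltn_ord.
  by rewrite sumr_const card_prod card_ord mulr_natl mulnn.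
have := trace_walks_ge0 k.+1.*2; rewrite -/T le_eqVlt => /orP[/eqP <-|T_gt0].
  by rewrite mulr_ge0 ?exprn_ge0 ?mulr_ge0.
rewrite -(ler_pM2r (exprn_gt0 k T_gt0)) -exprS.
apply: le_trans (lerXn2r _ _ _ T_le) _; rewrite ?nnegrE ?(ltW T_gt0) //.
  by rewrite !mulr_ge0 ?trace_walks_ge0.
rewrite exprMn -mulrA ler_wpM2l ?exprn_ge0 ?mulr_ge0 //.
exact: trace_walks_upper.
Qed.

End Walks.

(** * Stepanov's method *)

Lemma poly_linear_dependence (K : fieldType) (n N : nat) (B : 'I_n -> {poly K}) :
    (N < n)%N -> (forall k, (size (B k) <= N)%N) ->
  exists2 w : 'rV[K]_n, w != 0 & \sum_k w 0 k *: B k = 0.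
Proof.
move=> Nn sB; pose M := \matrix_(k < n, l < N) (B k)`_l.
have ker_neq0 : kermx M != 0.
  by rewrite kermx_eq0 -row_leq_rank -ltnNge (leq_ltn_trans (rank_leq_col M)).
exists (nz_row (kermx M)); first by rewrite nz_row_eq0.
set w := nz_row _; have wM : w *m M = 0 by apply/sub_kermxP; exact: nz_row_sub.
apply/polyP => l; rewrite coef0 coef_sum.
under eq_bigr do rewrite coefZ.
case: (ltnP l N) => lN.
  have /matrixP/(_ 0 (Ordinal lN)) := wM; rewrite !mxE => wMl; rewrite -[RHS]wMl.
  by apply: eq_bigr => k _; rewrite mxE.
by apply: big1 => k _; rewrite nth_default ?mulr0 // (leq_trans (sB k)).
Qed.

(** The degrees are distinct, so the largest index with a nonzero coefficient supplies an
    uncancelled leading term. *)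
Lemma poly_sum_staircase_neq0 (K : fieldType) (n C : nat) (P : 'I_n -> {poly K})
    (v : 'I_n -> K) :
    (forall k : 'I_n, size (P k) = (k + C).+1) -> (exists k, v k != 0) ->
  \sum_k v k *: P k != 0.
Proof.
move=> sP [k0 vk0].
have [k vk kmax] := @arg_maxnP _ k0 (fun k => v k != 0) (fun k : 'I_n => k : nat) vk0.
apply/eqP => /(congr1 (fun p : {poly K} => p`_(k + C))) /eqP; apply/negP.
rewrite coef0 coef_sum (bigD1 k) //= big1 ?addr0 => [|j jk].
  rewrite coefZ mulf_neq0 //.
  have : lead_coef (P k) != 0 by rewrite lead_coef_eq0 -size_poly_eq0 sP.
  by rewrite lead_coefE sP.
rewrite coefZ; case: (eqVneq (v j) 0) => [->|vj]; first by rewrite mul0r.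
rewrite nth_default ?mulr0 // sP -addSn leq_add2r ltn_neqAle [(_ <= _)%N](kmax j vj) andbT.
by rewrite (inj_eq val_inj).
Qed.

(** The polynomial ['X^#|T| - 'X] has at most [#|T|] roots, and [f] already provides that many. This
    recognizes elements of the prime field, and later elements of a field inside its quadratic
    extension. *)
Lemma pow_fixed_codom (K : fieldType) (T : finType) (f : T -> K) (y : K) :
    (1 < #|T|)%N -> injective f -> (forall t, f t ^+ #|T| = f t) ->
  y ^+ #|T| = y -> exists t, y = f t.
Proof.
move=> T_gt1 f_inj fT yT.
have [/codomP[t ->]|ynf] := boolP (y \in codom f); first by exists t.
pose P : {poly K} := 'X^#|T| - 'X.
have sP : size P = #|T|.+1 by rewrite size_polyDl size_polyXn // size_polyN size_polyX.
have : (size (y :: codom f) < size P)%N.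
  apply: max_poly_roots; first by rewrite -size_poly_eq0 sP.
    rewrite /= /root !hornerE yT subrr eqxx /=; apply/allP => _ /codomP[t ->].
    by rewrite /root !hornerE fT subrr.
  by rewrite /= ynf map_inj_uniq ?enum_uniq.
by rewrite /= size_codom sP ltnn.
Qed.

(** * The absolute trace *)

Section AbsoluteTrace.
Variables (p : nat) (L : finFieldType) (n : nat).
Hypotheses (p_pr : prime p) (L_card : #|L| = (p ^ n)%N).

Lemma card_pchar : p \in [pchar L].
Proof. exact: card_finPcharP L_card p_pr. Qed.

Lemma frobD i (x y : L) : (x + y) ^+ (p ^ i) = x ^+ (p ^ i) + y ^+ (p ^ i).
Proof. by apply: exprDn_pchar; rewrite pnatX pnatE ?card_pchar. Qed.

Lemma frob_sum i (I : Type) (s : seq I) (P : pred I) (f : I -> L) :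
  (\sum_(k <- s | P k) f k) ^+ (p ^ i) = \sum_(k <- s | P k) f k ^+ (p ^ i).
Proof.
apply: (big_morph (fun x => x ^+ (p ^ i)) (frobD i)).
by rewrite expr0n gtn_eqF // expn_gt0 prime_gt0.
Qed.

Lemma frob_nat i k : (k%:R : L) ^+ (p ^ i) = k%:R.
Proof.
elim: k => [|k IHk]; first by rewrite expr0n gtn_eqF // expn_gt0 prime_gt0.
by rewrite -natr1 frobD IHk expr1n.
Qed.

Lemma frob_card (x : L) : x ^+ (p ^ n) = x.
Proof. by rewrite -L_card expf_card. Qed.

Definition abs_trace (x : L) : L := \sum_(i < n) x ^+ (p ^ i).

Lemma abs_traceD : {morph abs_trace : x y / x + y}.
Proof.
by move=> x y; rewrite /abs_trace -big_split; apply: eq_bigr => i _; rewrite /= frobD.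
Qed.

Lemma natr_eqmod k1 k2 : k1%:R = k2%:R :> L -> k1 = k2 %[mod p].
Proof.
wlog k12 : k1 k2 / (k2 <= k1)%N => [hw|] E.
  by case/orP: (leq_total k1 k2) => /hw; [move=> H; apply/esym/H | apply].
by apply/eqP; rewrite eqn_mod_dvd // (dvdn_pcharf card_pchar) natrB // E subrr.
Qed.

Lemma natr_ord_inj (k1 k2 : 'I_p) : k1%:R = k2%:R :> L -> k1 = k2.
Proof.
by move/natr_eqmod; rewrite !modn_small ?ltn_ord // => /val_inj.
Qed.

(** Raising to the power [p] permutes the summands cyclically, so the trace lies in the prime
    field. *)
Lemma abs_trace_prime x : exists k : 'I_p, abs_trace x = k%:R.
Proof.
have := @pow_fixed_codom L 'I_p (fun k => k%:R) (abs_trace x); rewrite card_ord.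
apply; first exact: prime_gt1.
- exact: natr_ord_inj.
- by move=> k; rewrite -[X in _ ^+ X = _]expn1 frob_nat.
rewrite -{1}(expn1 p) frob_sum /abs_trace.
have := frob_card; case: n => [|m] fr; first by rewrite !big_ord0.
rewrite big_ord_recr big_ord_recl /= -!exprM -!expnD addn1 fr addrC.
by congr (_ + _); apply: eq_bigr => i _; rewrite -exprM -expnD addn1.
Qed.

End AbsoluteTrace.

Section Stepanov.
Variables (p m : nat) (L : finFieldType).
Hypotheses (p_pr : prime p) (L_card : #|L| = (p ^ m.+1.*2)%N).
Variables (a b : L) (c : 'I_p).
Hypothesis a_neq0 : a != 0.

(** Here [#|L| = r ^ 2] and [r = p * s]. An index [k < n] is written in digits as
    [k = e + s i + r j] with [e < s], [i < p] and [j < s.+2]. *)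
Let s := (p ^ m)%N.
Let r := (p ^ m.+1)%N.
Let n := (r * s.+2)%N.
Let ke (k : nat) := (k %% s)%N.
Let ki (k : nat) := ((k %/ s) %% p)%N.
Let kj (k : nat) := (k %/ r)%N.

Let p_gt1 : (1 < p)%N. Proof. exact: prime_gt1. Qed.
Let s_gt0 : (0 < s)%N. Proof. by rewrite expn_gt0 prime_gt0. Qed.
Let rE : r = (p * s)%N. Proof. exact: expnS. Qed.

Let kE k : (ke k + kj k * r + s * ki k = k)%N.
Proof.
rewrite [RHS](divn_eq _ s) [in RHS](divn_eq (k %/ s) p) -divnMA (mulnC s p) -rE.
by rewrite mulnDl -mulnA -rE -/(ke k) -/(ki k) -/(kj k); lia.
Qed.

Let ke_lt k : (ke k < s)%N. Proof. exact: ltn_pmod. Qed.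
Let ki_lt k : (ki k < p)%N. Proof. by apply: ltn_pmod; exact: prime_gt0. Qed.
Let kj_lt k : (k < n)%N -> (kj k < s.+2)%N.
Proof. by move=> kn; rewrite ltn_divLR ?expn_gt0 ?prime_gt0 // mulnC. Qed.

(* Let [f = a X + b / X] and [Y = \sum_(l < m.+1) f^(p^l)], so [Z = X^s Y] and
   the trace of [f] is [Y + Y^r].  If it equals [c] at [x], then
   [(c - Y)^r = Y] and [x^(r^2) = x], whence [(P k)^r] and [B k] agree at [x] up
   to a power of [x] not depending on [k].  A linear relation
   [\sum_k w_k *: B k = 0], which exists because the [n] polynomials [B k] have
   size less than [n], thus makes [\sum_k w_k^r *: P k] vanish at all such [x]; this
   polynomial is nonzero because the degrees of the [P k] are distinct. *)
Let Z : {poly L} := \sum_(l < m.+1)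
  ((a ^+ (p ^ l)) *: 'X^(s + p ^ l) + (b ^+ (p ^ l)) *: 'X^(s - p ^ l)).
Let W : {poly L} := c%:R *: 'X^s - Z.
Let P k : {poly L} := 'X^(ke k + kj k * r + s * (p.-1 - ki k)) * W ^+ ki k.
Let B k : {poly L} := 'X^(ke k * r + kj k + s * (p.-1 - ki k)) * Z ^+ ki k.

Let size_termM (d d' : nat) (u v : L) : (d' <= d)%N ->
  (size (u *: 'X^d + v *: 'X^d' : {poly L})%R <= d.+1)%N.
Proof.
move=> d'd; rewrite (leq_trans (size_polyD _ _)) // geq_max.
by rewrite !(leq_trans (size_scale_leq _ _)) ?size_polyXn.
Qed.

Let size_Z : size Z = (s + s).+1.
Proof.
rewrite /Z big_ord_recr /= addrC -addrA -/s subnn expr0.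
have aXs : size ((a ^+ s) *: 'X^(s + s) : {poly L}) = (s + s).+1.
  by rewrite size_scale ?expf_neq0 // size_polyXn.
rewrite size_polyDl aXs // ltnS (leq_trans (size_polyD _ _)) // geq_max.
apply/andP; split.
  by rewrite (leq_trans (size_scale_leq _ _)) // size_poly1 addn_gt0 s_gt0.
rewrite (leq_trans (size_sum _ _ _)) //; apply/bigmax_leqP => l _.
have lm : (p ^ l < s)%N by rewrite ltn_exp2l.
by rewrite (leq_trans (size_termM _ _ _)) //; lia.
Qed.

Let size_W : size W = (s + s).+1.
Proof.
rewrite /W addrC size_polyDl size_polyN size_Z //.
by rewrite ltnS (leq_trans (size_scale_leq _ _)) // size_polyXn; lia.
Qed.

Let size_XnM_exp d i (Q : {poly L}) : size Q = (s + s).+1 ->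
  size ('X^d * Q ^+ i) = (d + (s + s) * i).+1.
Proof.
move=> sQ; have Q_neq0 : Q != 0 by rewrite -size_poly_eq0 sQ.
rewrite mulrC size_mulXn ?expf_neq0 // -[in LHS](prednK (_ : 0 < size _)%N).
  by rewrite size_exp sQ addnS.
by rewrite lt0n size_poly_eq0 expf_neq0.
Qed.

(** Each factor [W], of degree [2 s], replaces a factor ['X^s], so the degree is [k] up to a fixed
    shift. *)
Let size_P k : size (P k) = (k + s * p.-1).+1.
Proof.
rewrite /P size_XnM_exp // -[in RHS](kE k).
have kip : (ki k <= p.-1)%N by rewrite -ltnS prednK ?prime_gt0.
have := leq_mul (leqnn s) kip; rewrite mulnBr; lia.
Qed.

Let size_B k : (k < n)%N -> (size (B k) < n)%N.
Proof.
move=> kn; rewrite /B size_XnM_exp //.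
have := kj_lt kn; have := ke_lt k; have := ki_lt k => kip kes kjs.
have h1 : (ke k * r + r <= s * r)%N by rewrite -mulSnr leq_mul2r kes orbT.
have h2 : (s * (p.-1 - ki k) + (s + s) * ki k <= 2 * (s * p.-1))%N.
  have {}kip : (ki k <= p.-1)%N by rewrite -ltnS prednK ?prime_gt0.
  have := leq_mul (leqnn s) kip; rewrite mulnBr; lia.
have h3 : (s * p.-1 + s = r)%N by rewrite -mulnSr prednK ?prime_gt0 // rE mulnC.
have h4 : (1 < r)%N by rewrite rE (leq_trans p_gt1) // leq_pmulr.
by rewrite /n mulnSr mulnSr (mulnC r s); lia.
Qed.

Let f (x : L) := a * x + b / x.

Let abs_trace_half (x : L) :
  abs_trace p m.+1.*2 x = abs_trace p m.+1 x + abs_trace p m.+1 x ^+ r.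
Proof.
rewrite /abs_trace -addnn big_split_ord /= (frob_sum p_pr L_card).
by congr (_ + _); apply: eq_bigr => i _; rewrite -exprM -expnD addnC.
Qed.

Let horner_Z (x : L) : x != 0 -> Z.[x] = x ^+ s * abs_trace p m.+1 (f x).
Proof.
move=> x_neq0; rewrite /Z horner_sum /abs_trace mulr_sumr.
apply: eq_bigr => l _; rewrite !hornerE (frobD p_pr L_card) exprD.
have lm : (p ^ l <= s)%N by rewrite leq_pexp2l ?prime_gt0 // -ltnS.
by rewrite expfB_cond ?(negPf x_neq0) // !exprMn exprVn; ring.
Qed.

(** The average fibre has about [#|L| / p = r * s] elements, so the excess [3 * r] is of the order
    of the square root of [#|L|]. *)
Lemma card_trace_fiber_lt :
  (#|[set x : L | (x != 0) && (abs_trace p m.+1.*2 (a * x + b / x) == c%:R)]%R|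
     < r * s + 3 * r)%N.
Proof.
have [||w w_neq0 wB] := @poly_linear_dependence L n n.-1 (fun k => B k) _ _.
  by rewrite prednK // muln_gt0 expn_gt0 prime_gt0.
  by move=> k; rewrite -ltnS (ltn_predK (size_B (ltn_ord k))) size_B.
pose G := \sum_(k < n) (w 0 k ^+ r) *: P k.
have G_neq0 : G != 0.
  apply: (poly_sum_staircase_neq0 (C := (s * p.-1)%N)) => [k|]; first exact: size_P.
  have [k wk] : exists k, w 0 k != 0.
    apply/existsP; apply: contraNT w_neq0; rewrite negb_exists => /forallP w0.
    by apply/eqP/rowP => k; rewrite mxE; apply/eqP/negPn.
  by exists k; rewrite expf_neq0.
have G_size : (size G <= n + s * p.-1)%N.
  rewrite (leq_trans (size_sum _ _ _)) //; apply/bigmax_leqP => k _.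
  by rewrite (leq_trans (size_scale_leq _ _)) // size_P ltn_add2r.
set A := [set x | _].
have : (#|A| < size G)%N.
  rewrite cardE; apply: max_poly_roots => //; last exact: enum_uniq.
  apply/allP => x; rewrite mem_enum inE => /andP[x_neq0 /eqP trx].
  have key k : x ^+ (s * p.-1) * (w 0 k ^+ r * (P k).[x]) ^+ r =
               x ^+ (s * r * p.-1) * (w 0 k * (B k).[x]).
    have xQ y : y ^+ (r * r) = y :> L.
      by rewrite -[RHS](frob_card L_card) -expnD addnn.
    have UY : (c%:R - abs_trace p m.+1 (f x)) ^+ r = abs_trace p m.+1 (f x).
      move: trx; rewrite abs_trace_half => <-.
      rewrite addrAC subrr add0r -exprM xQ //.
    have WE : W.[x] = x ^+ s * (c%:R - abs_trace p m.+1 (f x)).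
      by rewrite /W !hornerE horner_Z // mulrBr mulrC.
    rewrite /P /B !hornerM !horner_exp !hornerX WE horner_Z //.
    have kip : (ki k <= p.-1)%N by rewrite -ltnS prednK ?prime_gt0.
    move: (ke k) (kj k) (ki k) kip (abs_trace _ _ _) UY => e j i ip Y UY.
    set U := c%:R - Y in UY *.
    transitivity ((w 0 k ^+ (r * r)) * (x ^+ (s * p.-1) *
        x ^+ ((e + j * r + s * (p.-1 - i)) * r) * x ^+ (s * i * r)) * (U ^+ r) ^+ i).
      rewrite !exprMn -!exprM (mulnC r i) (mulnA s i r).
      move: (w 0 k ^+ _) (x ^+ _) (x ^+ _) (x ^+ _) (U ^+ _) => y1 y2 y3 y4 y5; ring.
    transitivity (w 0 k * (x ^+ (s * r * p.-1) *
        x ^+ (e * r + j + s * (p.-1 - i)) * x ^+ (s * i)) * Y ^+ i); last first.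
      rewrite !exprMn -!exprM.
      move: (x ^+ _) (x ^+ _) (x ^+ _) (Y ^+ _) => y1 y2 y3 y4; ring.
    rewrite xQ UY -!exprD; congr (_ * _ * _).
    (* The gain of the method: [x ^+ (r * r) = x] shrinks the exponent [r * r * j] to [j]. *)
    transitivity (x ^+ (s * r * p.-1 + e * r + s * p.-1) * (x ^+ (r * r)) ^+ j).
      rewrite -exprM -exprD; congr (_ ^+ _).
      by rewrite -[in LHS](subnK ip) addnK -[in RHS](subnK ip); nia.
    rewrite xQ -exprD; congr (_ ^+ _).
    by rewrite -[in LHS](subnK ip) -[in RHS](subnK ip) addnK; nia.
  have : x ^+ (s * p.-1) * G.[x] ^+ r = 0.
    rewrite /G horner_sum (frob_sum p_pr L_card) mulr_sumr.
    under eq_bigr do rewrite hornerZ key.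
    rewrite -mulr_sumr.
    under eq_bigr do rewrite -hornerZ.
    by rewrite -horner_sum wB horner0 mulr0.
  move/eqP; rewrite mulf_eq0 expf_eq0 (negPf x_neq0) andbF /= expf_eq0.
  by case/andP.
move=> /leq_trans /(_ G_size) /leq_trans; apply.
(* The bound on [size G] is [n + s * p.-1 = r * s + 3 * r - s]. *)
have h3 : (s * p.-1 + s = r)%N by rewrite -mulnSr prednK ?prime_gt0 // rE mulnC.
by rewrite /n; nia.
Qed.
End Stepanov.

(** * Kloosterman sums *)

Lemma quadratic_extension (F : finFieldType) (g : F) : (forall v, v ^+ 2 != g) ->
  exists (L : finFieldType) (iota : {rmorphism F -> L}) (z : L),
    #|L| = (#|F| ^ 2)%N /\ z ^+ 2 = iota g.
Proof.
move=> g_nsq.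
have sg : size ('X^2 - g%:P : {poly F}) = 3.
  by rewrite size_polyDl size_polyXn // size_polyN (leq_ltn_trans (size_polyC_leq1 _)).
have irr_g : irreducible_poly ('X^2 - g%:P : {poly F}).
  apply: cubic_irreducible => [|x]; first by rewrite sg.
  by rewrite /root !hornerE subr_eq0.
have [L0 dimL [z rootz _]] := irredp_FAdjoin irr_g.
pose L : finFieldType := FinFieldExtType L0.
exists L, (GRing.RMorphism.clone F L (in_alg L0) _), z; split.
  rewrite (_ : #|L| = #|finvect_type L0|) //.
  rewrite -(@card_vspacef F _ (Vector.class (finvect_type L0))) card_vspace.
  by rewrite [\dim _]dimL sg.
move: rootz; rewrite rmorphB /= map_polyXn map_polyC /root !hornerE subr_eq0.
by move/eqP.
Qed.

(** * Squares and their twist by a nonsquare *)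

Section SquareSums.
Variables (F : finFieldType) (g : F).
Hypothesis g_nsq : forall v, v ^+ 2 != g.

Let g_neq0 : g != 0.
Proof. by have := g_nsq 0; rewrite expr0n eq_sym. Qed.

Lemma card_sqrt_le2 (h w : F) : h != 0 -> (#|[set v | h * v ^+ 2 == w]%R| <= 2)%N.
Proof.
move=> h_neq0.
have [-> //|/finset.set0Pn[v0]] := eqVneq [set v | h * v ^+ 2 == w] finset.set0.
  by rewrite cards0.
rewrite inE => /eqP v0w; apply: (@leq_trans #|[set v0; - v0]|).
  apply/subset_leq_card/fintype.subsetP => v; rewrite !inE -v0w.
  by rewrite (inj_eq (mulfI h_neq0)) eqf_sqr.
by rewrite cards2; case: (_ != _).
Qed.

(* Both counts are at most 2 and never both positive unless [w = 0]; their sum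
   is therefore at most 2, and it averages 2 over [w]. *)
Lemma card_sqrt_twist (w : F) :
  (#|[set v | v ^+ 2 == w]%R| + #|[set v | g * v ^+ 2 == w]%R| = 2)%N.
Proof.
have one_le2 u : (#|[set v : F | v ^+ 2 == u]%R| <= 2)%N.
  have := card_sqrt_le2 u (oner_neq0 F).
  by rewrite (_ : [set v | 1 * v ^+ 2 == u] = [set v | v ^+ 2 == u]) //;
     apply/finset.setP => v; rewrite !inE mul1r.
pose N u := (#|[set v | v ^+ 2 == u]%R| + #|[set v | g * v ^+ 2 == u]%R|)%N.
have N_le2 u : (N u <= 2)%N.
  have [->|u_neq0] := eqVneq u 0.
    rewrite /N (_ : [set v | _] = [set 0]); last first.
      by apply/finset.setP => v; rewrite !inE sqrf_eq0.
    rewrite (_ : [set v | _] = [set 0]) ?cards1 //.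
    by apply/finset.setP => v; rewrite !inE mulf_eq0 (negPf g_neq0) sqrf_eq0.
  have [E0|/finset.set0Pn[v0]] := eqVneq [set v | v ^+ 2 == u] finset.set0.
    by rewrite /N E0 cards0 add0n card_sqrt_le2.
  rewrite inE => /eqP v0u; rewrite /N [X in (_ + X)%N](_ : _ = 0%N) ?addn0 //.
  apply/eqP; rewrite cards_eq0; apply/eqP/finset.setP => v; rewrite !inE.
  apply: contraNF (g_nsq (v0 / v)) => /eqP vu.
  have v_neq0 : v != 0 by apply: contraNneq u_neq0 => v0'; rewrite -vu v0' expr0n mulr0.
  by rewrite expr_div_n v0u -vu mulfK // sqrf_eq0.
have N_sum : (\sum_u (2 - N u) = 0)%N.
  rewrite sumnB => [|u _]; last exact: N_le2.
  rewrite sum_nat_const muln2 big_split /=.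
  have cnt (f : F -> F) : (\sum_u #|[set v | f v == u]| = #|F|)%N.
    rewrite -cardsT -[in RHS]sum1_card [RHS](partition_big f xpredT) //=; apply: eq_bigr => u _.
    by rewrite -sum1_card; apply: eq_bigl => v; rewrite !inE.
  by rewrite !cnt addnn subnn.
move/eqP: N_sum; rewrite sum_nat_eq0 => /forallP/(_ w).
by rewrite subn_eq0 => Nw; apply/eqP; rewrite eqn_leq N_le2.
Qed.

(** Together [v ^+ 2] and [g * v ^+ 2] hit each [w] exactly twice, so two sums over squares add up
    to a complete sum. *)
Lemma sum_square_twist (M : zmodType) (phi : F -> M) :
  \sum_v phi (v ^+ 2) + \sum_v phi (g * v ^+ 2) = (\sum_w phi w) *+ 2.
Proof.
have E (f : F -> F) : \sum_v phi (f v) = \sum_w phi w *+ #|[set v | f v == w]|.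
  rewrite (partition_big f xpredT) //=; apply: eq_bigr => w _.
  rewrite (eq_bigr (fun=> phi w)) => [|v /eqP -> //].
  by rewrite sumr_const; congr (_ *+ _); apply: eq_card => v; rewrite inE.
rewrite (E (fun v => v ^+ 2)) (E (fun v => g * v ^+ 2)) -big_split -sumrMnl; apply: eq_bigr => w _ /=.
by rewrite -mulrnDr card_sqrt_twist.
Qed.

End SquareSums.

(** Squaring identifies [1] and [-1], so it is not injective and hence not surjective. *)
Lemma exists_nonsquare (F : finFieldType) :
  (2 : F) != 0 -> exists g : F, forall v, v ^+ 2 != g.
Proof.
move=> two_neq0.
pose sq (v : F) := v ^+ 2.
have [/forallP sqT|] := boolP [forall g, g \in codom sq]; last first.
  rewrite negb_forall => /existsP[g gn]; exists g => v.
  by apply: contraNneq gn => <-; exact: (codom_f sq).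
have /image_injP sq_inj : #|codom sq| == #|F|.
  by apply/eqP/eq_card => g; rewrite [LHS]sqT.
have /eqP : 1 = -1 :> F by apply: sq_inj; rewrite // /sq sqrrN.
by rewrite -subr_eq0 opprK (negPf two_neq0).
Qed.

(** * Additive characters and their Kloosterman sums *)

Definition additive_character (F : finFieldType) (psi : F -> algC) :=
  [/\ psi 0 = 1, {morph psi : x y / x + y >-> x * y} & exists x, psi x != 1].

Definition kloosterman (F : finFieldType) (psi : F -> algC) (a b : F) : algC :=
  \sum_(x | x != 0) psi (a * x + b / x).

Section AdditiveCharacter.
Variables (F : finFieldType) (psi : F -> algC).
Hypothesis psi_char : additive_character psi.

Lemma char0 : psi 0 = 1. Proof. by case: psi_char. Qed.

Lemma charD x y : psi (x + y) = psi x * psi y.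
Proof. by case: psi_char => _ + _; exact. Qed.

Lemma charN x : psi x * psi (- x) = 1.
Proof. by rewrite -charD subrr char0. Qed.

Lemma char_neq0 x : psi x != 0.
Proof. by apply/eqP => px; have /eqP := charN x; rewrite px mul0r eq_sym oner_eq0. Qed.

Lemma char_sum (I : Type) (s : seq I) (P : pred I) (f : I -> F) :
  psi (\sum_(i <- s | P i) f i) = \prod_(i <- s | P i) psi (f i).
Proof. exact: (big_morph psi charD char0). Qed.

Lemma char_norm x : `|psi x| = 1.
Proof.
have [p p_pr F_pchar] := finPcharP F.
have psiMn n : psi x ^+ n = psi (x *+ n).
  by elim: n => [|n IHn]; rewrite ?mulr0n ?char0 // exprS mulrS charD IHn.
apply/eqP; rewrite -(@pexpr_eq1 _ _ p) ?normr_ge0 ?prime_gt0 //.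
by rewrite -normrX psiMn (mulrn_pchar F_pchar) char0 normr1.
Qed.

Lemma char_conj x : (psi x)^* = psi (- x).
Proof.
apply: (mulfI (char_neq0 x)); rewrite charN.
by have := normCK (psi x); rewrite char_norm expr1n => <-.
Qed.

Lemma sum_char_eq0 : \sum_x psi x = 0.
Proof.
case: psi_char => _ _ [x0 px0].
have : psi x0 * (\sum_x psi x) = \sum_x psi x.
  rewrite mulr_sumr [RHS](reindex_inj (addrI x0)) /=.
  by apply: eq_bigr => x _; rewrite charD.
move/eqP; rewrite -subr_eq0 -[X in _ - X]mul1r -mulrBl mulf_eq0 subr_eq0.
by rewrite (negPf px0) => /eqP.
Qed.

Lemma sum_charM a : \sum_x psi (a * x) = if a == 0 then #|F|%:R else 0.
Proof.
have [->|a_neq0] := eqVneq a 0.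
  by under eq_bigr do rewrite mul0r char0; rewrite sumr_const.
by rewrite -[RHS]sum_char_eq0 [RHS](reindex_inj (mulfI a_neq0)).
Qed.

Lemma kloosterman_real a b : kloosterman psi a b \is Num.real.
Proof.
rewrite CrealE /kloosterman rmorph_sum (reindex_inj oppr_inj) /=.
apply/eqP; apply: eq_big => [x|x _]; first by rewrite oppr_eq0.
by rewrite char_conj invrN mulrN mulrN opprD !opprK.
Qed.

End AdditiveCharacter.

(** The character [zeta^(Tr x)]; the default [1] is never reached when [p] is prime and
    [#|L| = p ^ n]. Using one [zeta] for all fields makes the characters compatible along
    extensions. *)
Definition trace_char (p n : nat) (zeta : algC) (L : finFieldType) (x : L) : algC :=
  if [pick k : 'I_p | abs_trace p n x == k%:R] is Some k then zeta ^+ k else 1.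

Section TraceChar.
Variables (p n : nat) (zeta : algC) (L : finFieldType).
Hypotheses (p_pr : prime p) (L_card : #|L| = (p ^ n)%N).
Hypothesis zeta_prim : p.-primitive_root zeta.

Local Notation psi := (@trace_char p n zeta L).

Lemma trace_charE (x : L) k : abs_trace p n x = k%:R -> psi x = zeta ^+ k.
Proof.
move=> xk; rewrite /trace_char; case: pickP => [k' /eqP xk'|none]; last first.
  have [k' xk'] := abs_trace_prime p_pr L_card x.
  by have := none k'; rewrite xk' eqxx.
apply/eqP; rewrite (eq_prim_root_expr zeta_prim); apply/eqP.
by apply: (natr_eqmod p_pr L_card); rewrite -xk.
Qed.

Lemma trace_char_additive : (0 < n)%N -> additive_character psi.
Proof.
move=> n_gt0; split.
- rewrite (@trace_charE _ 0) ?expr0 // /abs_trace big1 // => i _.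
  by rewrite expr0n gtn_eqF // expn_gt0 prime_gt0.
- move=> x y.
  have [k1 xk] := abs_trace_prime p_pr L_card x.
  have [k2 yk] := abs_trace_prime p_pr L_card y.
  rewrite (trace_charE xk) (trace_charE yk) -exprD; apply: trace_charE.
  by rewrite (abs_traceD p_pr L_card) xk yk natrD.
(* Were the character trivial, the trace polynomial [T] of degree [p ^ n.-1] would vanish on all
   [p ^ n] elements. *)
pose T : {poly L} := \sum_(i < n) 'X^(p ^ i).
have sT : size T = (p ^ n.-1).+1.
  rewrite /T; case: n n_gt0 => // n' _; rewrite big_ord_recr /= addrC size_polyDl size_polyXn //.
  rewrite ltnS (leq_trans (size_sum _ _ _)) //; apply/bigmax_leqP => i _.
  by rewrite size_polyXn ltn_exp2l ?prime_gt1.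
have [/existsP[x px]|] := boolP [exists x, psi x != 1]; first by exists x.
rewrite negb_exists => /forallP psi1.
have : (size (enum L) < size T)%N.
  apply: max_poly_roots; [by rewrite -size_poly_eq0 sT | | exact: enum_uniq].
  apply/allP => x _; rewrite /root /T horner_sum.
  under eq_bigr do rewrite hornerXn.
  have [k xk] := abs_trace_prime p_pr L_card x.
  have := psi1 x; rewrite negbK (trace_charE xk) -/(abs_trace p n x) xk.
  rewrite -(prim_order_dvd zeta_prim) => /dvdnP[[|j] kE]; first by rewrite kE mul0n.
  by have := ltn_ord k; rewrite kE mulSn ltnNge leq_addr.
rewrite sT -cardT L_card ltnS leqNgt ltn_exp2l ?prime_gt1 //.
by rewrite prednK // leqnn.
Qed.

End TraceChar.

(** Fibres of the trace are bounded only from above. As the powers of [zeta] sum to 0, each count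
    [N c] may be replaced, up to sign, by its deficit [M - N c]; deficits are nonnegative and sum to
    [p M - (#|L| - 1) = 3 p r + 1]. *)
Lemma kloosterman_stepanov (p m : nat) (zeta : algC) (L : finFieldType) (a b : L) :
    prime p -> #|L| = (p ^ m.+1.*2)%N -> p.-primitive_root zeta -> a != 0 ->
  `|kloosterman (trace_char p m.+1.*2 zeta (L := L)) a b| <= (4 * p * p ^ m.+1)%:R.
Proof.
move=> p_pr L_card zeta_prim a_neq0; rewrite /kloosterman.
set r := (p ^ m.+1)%N; set n := m.+1.*2.
pose f x := a * x + b / x.
pose N (c : 'I_p) := #|[set x : L | (x != 0) && (abs_trace p n (f x) == c%:R)]|.
have psiE (x : L) : trace_char p n zeta x = \sum_(c < p) (abs_trace p n x == c%:R)%:R * zeta ^+ c.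
  have [k xk] := abs_trace_prime p_pr L_card x.
  rewrite (trace_charE p_pr L_card zeta_prim xk) (bigD1 k) //= xk eqxx mul1r.
  rewrite big1 ?addr0 // => c ck; case: eqP => [/(natr_ord_inj p_pr L_card) kc|_].
    by rewrite kc eqxx in ck.
  by rewrite mul0r.
have KE : \sum_(x | x != 0) trace_char p n zeta (f x) = \sum_(c < p) (N c)%:R * zeta ^+ c.
  under eq_bigr do rewrite psiE.
  rewrite exchange_big; apply: eq_bigr => c _ /=.
  rewrite -mulr_suml natr_cardE; congr (_ * _).
  by rewrite big_mkcond; apply: eq_bigr => x _; case: (x != 0).
have sumN : (\sum_(c < p) N c = #|L|.-1)%N.
  have NE c : N c = (\sum_(x : L) ((x != 0%R) && (abs_trace p n (f x) == c%:R)))%N.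
    by rewrite -[LHS]natn /N natr_cardE; apply: eq_bigr => x _; rewrite natn.
  under eq_bigr do rewrite NE.
  rewrite exchange_big /= -(cardC1 (0 : L)) -sum1_card [RHS]big_mkcond.
  apply: eq_bigr => x _; rewrite inE; case: (x != 0) => /=; last by rewrite big1.
  have [k xk] := abs_trace_prime p_pr L_card (f x).
  rewrite (bigD1 k) //= xk eqxx big1 // => c ck.
  case: eqP => // /(natr_ord_inj p_pr L_card) kc.
  by rewrite kc eqxx in ck.
have zeta_sum : \sum_(c < p) zeta ^+ c = 0.
  have /eqP := subrX1 zeta p; rewrite (prim_expr_order zeta_prim) subrr eq_sym.
  rewrite mulf_eq0 subr_eq0 => /orP[|/eqP //].
  have := prim_order_dvd zeta_prim 1; rewrite expr1 => <-.
  by rewrite dvdn1 gtn_eqF ?prime_gt1.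
have zeta_norm : `|zeta| = 1.
  apply/eqP; rewrite -(@pexpr_eq1 _ _ p) ?normr_ge0 ?prime_gt0 //.
  by rewrite -normrX (prim_expr_order zeta_prim) normr1.
pose M := (r * p ^ m + 3 * r)%N.
have -> : \sum_(x | x != 0) trace_char p n zeta (f x) =
    - \sum_(c < p) (M - N c)%:R * zeta ^+ c.
  apply/eqP; rewrite KE -subr_eq0 opprK -big_split /=; apply/eqP.
  transitivity (M%:R * \sum_(c < p) zeta ^+ c); last by rewrite zeta_sum mulr0.
  rewrite mulr_sumr; apply: eq_bigr => c _; rewrite natrB ?mulrBl; first by rewrite addrC subrK.
  exact/ltnW/card_trace_fiber_lt.
rewrite normrN (le_trans (ler_norm_sum _ _ _)) //.
apply: (@le_trans _ _ (\sum_(c < p) (M - N c)%:R)).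
  apply: ler_sum => c _; rewrite normrM normr_nat normrX.
  by rewrite zeta_norm expr1n mulr1.
rewrite -natr_sum ler_nat sumnB => [|c _]; last exact/ltnW/card_trace_fiber_lt.
rewrite sumN sum_nat_const card_ord L_card /M.
have -> : (p ^ m.+1.*2 = p * p ^ m * r)%N by rewrite -addnn expnD {1}expnS.
have pr_gt0 : (0 < p * r)%N by rewrite muln_gt0 prime_gt0 // expn_gt0 prime_gt0.
have -> : (p * (r * p ^ m + 3 * r) = p * p ^ m * r + 3 * (p * r))%N by ring.
by rewrite -mulnA; lia.
Qed.

(** * Kloosterman sums over a quadratic extension *)

Section QuadraticLift.
Variables (F L : finFieldType) (iota : {rmorphism F -> L}) (g : F) (z : L).
Hypotheses (g_nsq : forall v, v ^+ 2 != g) (z_sqr : z ^+ 2 = iota g).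
Hypothesis L_card : #|L| = (#|F| ^ 2)%N.
Hypothesis two_neq0 : (2 : F) != 0.

Let lift (uv : F * F) : L := iota uv.1 + iota uv.2 * z.

Let z_notin u : z != iota u.
Proof.
apply/eqP => zu; have := g_nsq u; apply/negP; rewrite negbK.
by rewrite -(inj_eq (fmorph_inj iota)) rmorphXn -z_sqr zu.
Qed.

Let lift_inj : injective lift.
Proof.
move=> [u v] [u' v']; rewrite /lift /= => E.
have Ev : iota (v - v') * z = iota (u' - u).
  rewrite !rmorphB mulrBl; apply/eqP; rewrite -subr_eq0.
  move/eqP: E; rewrite -subr_eq0.
  by move: (iota u) (iota v) (iota u') (iota v') => x1 y1 x2 y2; congr (_ == 0); ring.
have [vv'|vv'] := eqVneq v v'.
  by move: Ev; rewrite vv' subrr rmorph0 mul0r => /esym/eqP; rewrite fmorph_eq0 subr_eq0 => /eqP ->.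
have := z_notin ((u' - u) / (v - v')); rewrite fmorph_div -Ev mulrC mulKf ?eqxx //.
by rewrite fmorph_eq0 subr_eq0.
Qed.

Let lift_bij : bijective lift.
Proof. by apply: inj_card_bij lift_inj _; rewrite L_card card_prod mulnn. Qed.

(** The power has the same square as [z], and being equal to [z] would put [z] in the image of
    [F]. *)
Lemma frob_sqrt : z ^+ #|F| = - z.
Proof.
have : (z ^+ #|F|) ^+ 2 == z ^+ 2.
  by rewrite -exprM mulnC exprM z_sqr -rmorphXn expf_card.
rewrite eqf_sqr => /orP[/eqP zF|/eqP //].
have [|u zu] := @pow_fixed_codom _ _ iota z (finRing_gt1 F) (fmorph_inj iota) _ zF.
  by move=> t; rewrite -rmorphXn expf_card.
by have := z_notin u; rewrite zu eqxx.
Qed.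

(** Both terms sum [Phi u h] over pairs with half-sum [u] and product [h]: pairs [u + v], [u - v] in
    [F] with [h = u^2 - v^2], and conjugate pairs in [L] with [h = u^2 - g v^2]. By
    [sum_square_twist] the two together run over all [h] twice. *)
Lemma kloosterman_doubling (psi : F -> algC) (psiL : L -> algC) (a b : F) :
    additive_character psi ->
    (forall u v, psiL (iota u + iota v * z) = psi (u *+ 2)) -> a != 0 -> b != 0 ->
  kloosterman psi a b ^+ 2 + kloosterman psiL (iota a) (iota b) = #|F|%:R *+ 2.
Proof.
move=> psi_char psiLE a_neq0 b_neq0.
pose Phi u h := psi ((a * u + b * u / h) *+ 2).
pose phi (u w : F) := if u ^+ 2 - w != 0 then Phi u (u ^+ 2 - w) else 0.
have KL : kloosterman psiL (iota a) (iota b) = \sum_u \sum_v phi u (g * v ^+ 2).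
  rewrite /kloosterman (reindex lift) /=; last exact: onW_bij.
  rewrite pair_bigA big_mkcond; apply: eq_bigr => -[u v] _ /=.
  set y := lift (u, v); pose y' := iota u - iota v * z.
  have yy' : y * y' = iota (u ^+ 2 - g * v ^+ 2).
    rewrite /y /y' /lift /= rmorphB !rmorphXn [iota (g * _)]rmorphM rmorphXn -z_sqr.
    by move: (iota u) (iota v) => x1 y1; ring.
  have lift00 : lift (0, 0) = 0 by rewrite /lift /= rmorph0 mul0r addr0.
  have y_eq0 : (y == 0) = (u ^+ 2 - g * v ^+ 2 == 0).
    rewrite /y -lift00 (inj_eq lift_inj); apply/eqP/eqP => [[-> ->]|/eqP].
      by rewrite expr0n mulr0 subrr.
    rewrite subr_eq0; have [->|v_neq0] := eqVneq v 0.
      by rewrite expr0n mulr0 sqrf_eq0 => /eqP ->.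
    move=> /eqP uv; have := g_nsq (u / v).
    by rewrite expr_div_n uv mulfK ?sqrf_eq0 // eqxx.
  rewrite /phi -y_eq0; case: eqVneq => // y_neq0 /=.
  have N_neq0 : iota (u ^+ 2 - g * v ^+ 2) != 0.
    by rewrite fmorph_eq0 -y_eq0.
  have -> : iota a * y + iota b / y =
      iota (a * u + b * u / (u ^+ 2 - g * v ^+ 2)) +
      iota (a * v - b * v / (u ^+ 2 - g * v ^+ 2)) * z.
    have -> : y^-1 = y' / iota (u ^+ 2 - g * v ^+ 2).
      by apply: (mulfI y_neq0); rewrite mulfV // mulrA yy' mulfV.
    move: (u ^+ 2 - _) => N.
    rewrite rmorphD rmorphB !rmorphM fmorphV /y /y' /lift /=.
    move: (iota N)^-1 (iota a) (iota b) (iota u) (iota v) => N' a1 b1 u1 v1.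
    by ring.
  by rewrite psiLE.
have KF : kloosterman psi a b ^+ 2 = \sum_u \sum_v phi u (v ^+ 2).
  pose h (uv : F * F) : F * F := (uv.1 + uv.2, uv.1 - uv.2).
  have h_bij : bijective h.
    exists (fun xy : F * F => ((xy.1 + xy.2) / 2, (xy.1 - xy.2) / 2)) => -[x y]; rewrite /h /=;
      by congr (_, _); field.
  rewrite expr2 /kloosterman big_distrlr /= pair_big (reindex h) /=; last first.
    exact: onW_bij.
  rewrite pair_bigA big_mkcond; apply: eq_bigr => -[u v] _ /=.
  rewrite /phi; have -> : u ^+ 2 - v ^+ 2 = (u + v) * (u - v) by ring.
  rewrite mulf_eq0 negb_or; case: ifP => // /andP[x_neq0 y_neq0].
  rewrite -(charD psi_char); congr psi.
  by field; rewrite x_neq0 y_neq0.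
rewrite KF KL -big_split /=.
under eq_bigr do rewrite (sum_square_twist g_nsq).
rewrite sumrMnl; congr (_ *+ 2).
(* With the sum over [u] innermost, only [h = - b / a] survives; it contributes [#|F|]. *)
have -> : \sum_u \sum_w phi u w = \sum_(h | h != 0) \sum_u psi ((a + b / h) *+ 2 * u).
  rewrite exchange_big [RHS]exchange_big /=.
  rewrite exchange_big; apply: eq_bigr => u _.
  have subu_inj : injective (fun h => u ^+ 2 - h) by move=> h1 h2 /addrI/oppr_inj.
  rewrite (reindex_inj subu_inj) [RHS]big_mkcond; apply: eq_bigr => h _.
  rewrite /phi subKr; case: ifP => // _; congr psi.
  by rewrite mulrnAl mulrDl (mulrAC b).
under eq_bigr do rewrite (sum_charM psi_char).
rewrite (bigD1 (- b / a)) /=; last by rewrite mulf_neq0 ?oppr_eq0 ?invr_eq0.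
rewrite [X in _ + X]big1 ?addr0 => [|h /andP[h_neq0 hb]].
  by rewrite [X in X == 0](_ : _ = 0) ?eqxx //; field; rewrite ?oppr_eq0 ?b_neq0 ?a_neq0.
rewrite ifF //; apply/negP; rewrite -mulr_natr mulf_eq0 (negPf two_neq0) orbF.
rewrite addr_eq0 => /eqP ab; case/eqP: hb; rewrite ab.
by field; rewrite ?oppr_eq0 ?b_neq0 ?h_neq0.
Qed.
End QuadraticLift.

Lemma two_neq0_odd (p n : nat) (F : finFieldType) :
  prime p -> odd p -> #|F| = (p ^ n)%N -> (2 : F) != 0.
Proof.
move=> p_pr p_odd F_card; rewrite -(dvdn_pcharf (card_pchar p_pr F_card)).
apply: contraL p_odd => /dvdn_leq p_le2.
by have -> : p = 2%N by apply/eqP; rewrite eqn_leq p_le2 ?prime_gt1.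
Qed.

Lemma kloosterman_quadratic_lift (p n : nat) (zeta : algC) (F : finFieldType)
    (a b : F) :
    prime p -> odd p -> p.-primitive_root zeta -> (0 < n)%N -> #|F| = (p ^ n)%N ->
    a != 0 -> b != 0 ->
  exists (L : finFieldType) (a' b' : L),
    [/\ #|L| = (p ^ n.*2)%N, a' != 0, b' != 0 &
     kloosterman (trace_char p n zeta (L := F)) a b ^+ 2 +
     kloosterman (trace_char p n.*2 zeta (L := L)) a' b' = #|F|%:R *+ 2].
Proof.
move=> p_pr p_odd zeta_prim n_gt0 F_card a_neq0 b_neq0.
have two_neq0 := two_neq0_odd p_pr p_odd F_card.
have [g g_nsq] := exists_nonsquare two_neq0.
have [L [iota [z [L_card zg]]]] := quadratic_extension g_nsq.
have L_card' : #|L| = (p ^ n.*2)%N by rewrite L_card F_card -muln2 expnM.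
exists L, (iota a), (iota b); split; rewrite ?fmorph_eq0 //.
apply: (kloosterman_doubling g_nsq zg L_card two_neq0) => //.
  exact: trace_char_additive.
move=> u v; have [k uk] := abs_trace_prime p_pr F_card (u *+ 2).
rewrite (trace_charE p_pr F_card zeta_prim uk).
apply: (trace_charE p_pr L_card' zeta_prim).
(* The [#|F|]-th power is the conjugation of [L] over [F]; pairing the exponents [i] and [n + i] in
   the trace cancels [v z] and doubles [u]. *)
have yq : (iota u + iota v * z) ^+ (p ^ n) = iota u - iota v * z.
  rewrite (frobD p_pr L_card') exprMn -F_card -!rmorphXn !expf_card.
  by rewrite (frob_sqrt g_nsq zg) mulrN.
rewrite /abs_trace -addnn big_split_ord /= -big_split /=.
transitivity (iota (abs_trace p n (u *+ 2))); last by rewrite uk rmorph_nat.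
rewrite rmorph_sum; apply: eq_bigr => i _.
rewrite expnD exprM yq -(frobD p_pr L_card') rmorphXn rmorphMn /=.
by congr (_ ^+ _); rewrite addrACA subrr addr0.
Qed.

(* Writing [K^2 = 4q + e], the lift gives [K'^2 = 4q^2 + 4qe + e^2] over the
   quadratic extension, so the relative excess [e/q] grows at least fourfold at
   each step of a tower while the Stepanov bound keeps it bounded. *)
Theorem kloosterman_bound (p n : nat) (zeta : algC) (F : finFieldType) (a b : F) :
    prime p -> odd p -> p.-primitive_root zeta ->
    (0 < n)%N -> #|F| = (p ^ n)%N -> a != 0 -> b != 0 ->
  kloosterman (trace_char p n zeta (L := F)) a b ^+ 2 <= 4 * #|F|%:R.
Proof.
move=> p_pr p_odd zeta_prim n_gt0 F_card a_neq0 b_neq0.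
have real (F' : finFieldType) n' (a' b' : F') : (0 < n')%N -> #|F'| = (p ^ n')%N ->
    kloosterman (trace_char p n' zeta (L := F')) a' b' \is Num.real.
  by move=> n'_gt0 F'_card; apply/kloosterman_real/trace_char_additive.
have iter j : forall (F : finFieldType) (n : nat) (a b : F), (0 < n)%N ->
    #|F| = (p ^ n)%N -> a != 0 -> b != 0 ->
  4 ^+ j * (kloosterman (trace_char p n zeta (L := F)) a b ^+ 2 - 4 * #|F|%:R)
     <= 4 * p%:R * #|F|%:R.
  elim: j => [|j IHj] {}F {}n {}a {}b {}n_gt0 {}F_card {}a_neq0 {}b_neq0.
    (* One lift reaches an even exponent, where Stepanov's bound applies: [K^2 = 2 q - K'] with
       [|K'| <= 4 p q]. *)
    have [L [a' [b' [L_card a'_neq0 b'_neq0 KK]]]] :=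
      kloosterman_quadratic_lift p_pr p_odd zeta_prim n_gt0 F_card a_neq0 b_neq0.
    rewrite expr0 mul1r.
    have := real L n.*2 a' b'; rewrite double_gt0 => /(_ n_gt0 L_card) K'R.
    have K'_ge : - (4 * p%:R * #|F|%:R) <= kloosterman (trace_char p n.*2 zeta (L := L)) a' b'.
      case: n n_gt0 F_card L_card K'R {KK} => // m _ F_card L_card K'R.
      have := kloosterman_stepanov b' p_pr L_card zeta_prim a'_neq0.
      rewrite real_ler_norml // F_card.
      by rewrite !natrM => /andP[].
    rewrite -[X in X - _](addrK (kloosterman (trace_char p n.*2 zeta (L := L)) a' b')) KK.
    move: (kloosterman _ _ _) K'_ge => K' K'_ge.
    apply: (@le_trans _ _ (- K')); last by rewrite lerNl.
    rewrite -subr_ge0 (_ : _ - _ = #|F|%:R *+ 2) ?mulrn_wge0 ?ler0n //.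
    by ring.
  have [L [a' [b' [L_card a'_neq0 b'_neq0 KK]]]] :=
    kloosterman_quadratic_lift p_pr p_odd zeta_prim n_gt0 F_card a_neq0 b_neq0.
  have := real F n a b n_gt0 F_card.
  have := IHj L n.*2 a' b'; rewrite double_gt0 => /(_ n_gt0 L_card a'_neq0 b'_neq0).
  move: (kloosterman _ a b) (kloosterman _ a' b') KK => K K' KK + KR.
  have -> : #|L|%:R = #|F|%:R ^+ 2 :> algC.
    by rewrite L_card F_card -natrX -muln2 expnM.
  have -> : K' = #|F|%:R *+ 2 - K ^+ 2 by rewrite -KK addrAC subrr add0r.
  have q_gt0 : 0 < #|F|%:R :> algC by rewrite ltr0n (ltn_trans _ (finRing_gt1 F)).
  move: (#|F|%:R) q_gt0 => q q_gt0 IH.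
  rewrite -(ler_pM2r q_gt0) -[leRHS]mulrA -expr2; apply: le_trans IH.
  rewrite -subr_ge0 (_ : _ - _ = 4 ^+ j * (K ^+ 2 - 4 * q) ^+ 2); last first.
    by rewrite [4 ^+ j.+1]exprS; move: (4 ^+ j) => c; ring.
  apply: mulr_ge0; first by rewrite exprn_ge0 ?ler0n.
  apply: real_exprn_even_ge0 => //.
  by rewrite rpredB ?rpredX ?rpredM ?realn // gtr0_real.
set K := kloosterman _ a b.
have KR : K \is Num.real by exact: real.
set e := K ^+ 2 - 4 * #|F|%:R.
have eR : e \is Num.real by rewrite rpredB ?rpredX ?rpredM ?realn.
rewrite -subr_le0 -/e real_leNgt ?rpred0 //; apply/negP => e_gt0.
(* For this [j] the product [j * e] exceeds the bound of [iter], so [4 ^ j < j] would follow. *)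
pose j := Num.bound (4 * p%:R * #|F|%:R / e).
have B_ge0 : 0 <= 4 * p%:R * #|F|%:R :> algC by rewrite !mulr_ge0 ?ler0n.
have := archi_boundP (divr_ge0 B_ge0 (ltW e_gt0)); rewrite -/j.
rewrite ltr_pdivrMr // => jB.
have := iter j F n a b n_gt0 F_card a_neq0 b_neq0; rewrite -/K -/e => jB'.
have : 4 ^+ j * e < j%:R * e by apply: le_lt_trans jB' jB.
rewrite ltr_pM2r // -natrX ltr_nat ltnNge.
by rewrite ltnW // ltn_expl.
Qed.

(** * Gauss and Salie sums *)

Section GaussSums.
Variables (F : finFieldType) (psi : F -> algC).
Hypotheses (psi_char : additive_character psi) (two_neq0 : (2 : F) != 0).

Local Notation q := (#|F|%:R : algC).

Definition gauss_sum (s : F) : algC := \sum_x psi (s * x ^+ 2).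

Lemma gauss_sum_mul_sqr (s c : F) : c != 0 -> gauss_sum (s * c ^+ 2) = gauss_sum s.
Proof.
move=> c_neq0; rewrite [RHS](reindex_inj (mulfI c_neq0)).
by apply: eq_bigr => x _; congr psi; ring.
Qed.

Lemma gauss_sum_twist (g s : F) : (forall v, v ^+ 2 != g) -> s != 0 ->
  gauss_sum (g * s) = - gauss_sum s.
Proof.
move=> g_nsq s_neq0; apply/eqP; rewrite -addr_eq0 addrC.
have := sum_square_twist g_nsq (fun w => psi (s * w)).
rewrite (sum_charM psi_char) (negPf s_neq0) mul0rn => /eqP.
rewrite /gauss_sum; congr (_ + _ == 0); apply: eq_bigr => v _.
by rewrite mulrCA mulrA.
Qed.

(** Writing the first variable as [h + y] makes the phase linear in [y], and only [h = 0]
    survives. *)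
Lemma gauss_sum_sqr_norm (s : F) : s != 0 -> `|gauss_sum s| ^+ 2 = q.
Proof.
move=> s_neq0; rewrite normCK rmorph_sum.
have -> : gauss_sum s * (\sum_y (psi (s * y ^+ 2))^*) =
    \sum_h psi (s * h ^+ 2) * \sum_y psi ((s * h) *+ 2 * y).
  rewrite mulr_sumr; under [RHS]eq_bigr do rewrite mulr_sumr.
  rewrite [RHS]exchange_big; apply: eq_bigr => y _.
  rewrite mulr_suml (reindex_inj (addIr y)); apply: eq_bigr => h _ /=.
  rewrite (char_conj psi_char) -!(charD psi_char); congr psi.
  by ring.
rewrite [LHS](bigD1 (0 : F)) //= [X in _ + X]big1 ?addr0 => [|h h_neq0].
  by rewrite expr0n /= mulr0 (char0 psi_char) mul1r mul0rn (sum_charM psi_char) eqxx.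
rewrite (sum_charM psi_char) -mulr_natr !mulf_eq0 (negPf s_neq0) (negPf h_neq0).
by rewrite (negPf two_neq0) mulr0.
Qed.

Lemma gauss_sum_neq0 (s : F) : s != 0 -> gauss_sum s != 0.
Proof.
move=> /gauss_sum_sqr_norm Gq; rewrite -normr_eq0 -sqrf_eq0 Gq.
by rewrite pnatr_eq0 -lt0n (ltn_trans _ (finRing_gt1 F)).
Qed.

Let four_neq0 : (4 : F) != 0.
Proof. by rewrite (_ : 4 = 2 * 2) ?mulf_neq0 // -natrM. Qed.

Lemma sum_quadratic_char (s y : F) : s != 0 ->
  \sum_x psi (s * x ^+ 2 + x * y) = gauss_sum s * psi (- (y ^+ 2 / (4 * s))).
Proof.
move=> s_neq0; rewrite mulr_suml (reindex_inj (addIr (- (y / (2 * s))))) /=.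
apply: eq_bigr => x _; rewrite -(charD psi_char); congr psi.
by field; rewrite four_neq0 two_neq0 s_neq0.
Qed.

(** The sign [eps] is the value at [b] of the quadratic character, which is thus never introduced
    itself. *)
Lemma gauss_sum_sign (b : F) : b != 0 ->
  exists2 eps : algC, eps ^+ 2 = 1 & forall s, s != 0 -> gauss_sum (b * s) = eps * gauss_sum s.
Proof.
move=> b_neq0.
have [/existsP[c /eqP cb]|] := boolP [exists c, c ^+ 2 == b].
  exists 1 => [|s s_neq0]; first by rewrite expr1n.
  rewrite mul1r -cb mulrC gauss_sum_mul_sqr //.
  by apply: contraNneq b_neq0 => c0; rewrite -cb c0 expr0n.
rewrite negb_exists => /forallP b_nsq; exists (-1); first by rewrite sqrrN expr1n.
by move=> s s_neq0; rewrite gauss_sum_twist // mulN1r.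
Qed.

Lemma gauss_sum_sqr (s : F) : s != 0 -> gauss_sum s ^+ 2 = gauss_sum 1 ^+ 2.
Proof.
move=> s_neq0; have [eps eps2 /(_ 1 (oner_neq0 _))] := gauss_sum_sign s_neq0.
by rewrite mulr1 => ->; rewrite exprMn eps2 mul1r.
Qed.

Lemma gauss_sum_inv (s c : F) : s != 0 -> c != 0 -> gauss_sum (c / s) = gauss_sum (c * s).
Proof.
move=> s_neq0 c_neq0; rewrite -[RHS](@gauss_sum_mul_sqr _ s^-1) ?invr_eq0 //.
by congr gauss_sum; field.
Qed.

(** This is [gauss_sum 1] times the usual Salie sum, because [gauss_sum s / gauss_sum 1] is the
    quadratic character of [s]. *)
Definition salie (n b : F) : algC := \sum_(s | s != 0) gauss_sum s * psi (n * s + b / s).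

Lemma sum_char_neq0 a : \sum_(x | x != 0) psi (a * x) = (if a == 0 then q else 0) - 1.
Proof.
rewrite -(sum_charM psi_char) [in RHS](bigD1 (0 : F)) //= mulr0 (char0 psi_char).
by rewrite addrAC subrr add0r.
Qed.

(* The Fourier transform of [c |-> salie 1 (h c^2 / 4)] is explicit, and
   every [b] has this form with [h = 1] or [h] a fixed nonsquare. *)
Lemma salie1_bound b : `|salie 1 b| <= 3 * q.
Proof.
have [g g_nsq] := exists_nonsquare two_neq0.
have g_neq0 : g != 0 by have := g_nsq 0; rewrite expr0n eq_sym.
have q_gt0 : 0 < q by rewrite ltr0n (ltn_trans _ (finRing_gt1 F)).
have bound h c : h != 0 -> `|salie 1 (h * c ^+ 2 / 4)| <= 3 * q.
  move=> h_neq0; pose U c := salie 1 (h * c ^+ 2 / 4).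
  have [eps eps2 epsE] := gauss_sum_sign h_neq0.
  (* Completing the square in [c] yields a second Gauss sum; its product with [gauss_sum x] is
     independent of [x], which leaves a linear character sum in [x]. *)
  have UF gamma : \sum_c U c * psi (c * gamma) =
      eps * gauss_sum 1 ^+ 2 * ((if gamma ^+ 2 == h then q else 0) - 1).
    have -> : (gamma ^+ 2 == h) = (1 - gamma ^+ 2 / h == 0).
      by rewrite subr_eq0 [RHS]eq_sym -[RHS](inj_eq (mulIf h_neq0)) divfK // mul1r.
    rewrite -sum_char_neq0 mulr_sumr.
    under eq_bigr do rewrite mulr_suml.
    rewrite exchange_big; apply: eq_bigr => x x_neq0 /=.
    have hx_neq0 : h / (4 * x) != 0 by rewrite mulf_neq0 ?invr_eq0 ?mulf_neq0.
    transitivity (gauss_sum x * psi x * \sum_c psi (h / (4 * x) * c ^+ 2 + c * gamma)).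
      rewrite mulr_sumr; apply: eq_bigr => c' _; rewrite -!mulrA -!(charD psi_char).
      by congr (_ * psi _); field; rewrite four_neq0 x_neq0.
    rewrite sum_quadratic_char //.
    have -> : gauss_sum (h / (4 * x)) = eps * gauss_sum x.
      rewrite -epsE // -gauss_sum_inv // -[RHS](@gauss_sum_mul_sqr _ 2^-1) ?invr_eq0 //.
      by congr gauss_sum; field; rewrite four_neq0 two_neq0 x_neq0.
    rewrite -(gauss_sum_sqr x_neq0) mulrACA; set Y := psi _ * psi _.
    have -> : Y = psi ((1 - gamma ^+ 2 / h) * x).
      rewrite /Y -(charD psi_char); congr psi.
      by field; rewrite four_neq0 x_neq0 h_neq0.
    by ring.
  have invF : q * U c = \sum_gamma psi (- (c * gamma)) * \sum_c' U c' * psi (c' * gamma).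
    under eq_bigr do rewrite mulr_sumr.
    rewrite exchange_big (bigD1 c) //= [X in _ = _ + X]big1 ?addr0 => [|c' c'c].
      under eq_bigr do rewrite mulrCA [psi (- _) * _]mulrC (charN psi_char) mulr1.
      by rewrite sumr_const mulr_natl.
    under eq_bigr => gamma _.
      rewrite mulrCA -(charD psi_char) (_ : _ + _ = (c' - c) * gamma); last by ring.
      over.
    by rewrite -mulr_sumr (sum_charM psi_char) subr_eq0 (negPf c'c) mulr0.
  rewrite -/(U c) -(ler_pM2l q_gt0) -[X in X * `|_|]ger0_norm ?ler0n // -normrM invF.
  rewrite (le_trans (ler_norm_sum _ _ _)) //.
  have epsG : `|eps * gauss_sum 1 ^+ 2| = q.
    rewrite normrM normrX gauss_sum_sqr_norm ?oner_neq0 //.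
    have -> : `|eps| = 1.
      by apply/eqP; rewrite -(@pexpr_eq1 _ _ 2) ?normr_ge0 // -normrX eps2 normr1.
    by rewrite mul1r.
  (* At most two [gamma] satisfy [gamma ^+ 2 = h], so the sum is at most [q * (2 q + q)]. *)
  apply: (@le_trans _ _ (\sum_(gamma : F) q * ((if gamma ^+ 2 == h then q else 0) + 1))).
    apply: ler_sum => gamma _; rewrite normrM (char_norm psi_char) mul1r UF.
    rewrite normrM epsG ler_wpM2l ?ler0n // (le_trans (ler_normB _ _)) // normr1.
    by rewrite lerD2r; case: ifP; rewrite ?normr0 ?normr_nat.
  rewrite -mulr_sumr ler_wpM2l ?ler0n // big_split /= sumr_const.
  rewrite -big_mkcond /= sumr_const (_ : 3 * q = q *+ 2 + q); last by ring.
  rewrite lerD2r ler_pMn2l //.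
  have := card_sqrt_le2 h (oner_neq0 F); congr (_ <= _)%N.
  by apply: eq_card => v; rewrite !inE mul1r.
have := card_sqrt_twist g_nsq (b * 4).
have [->|/finset.set0Pn[v]] := eqVneq [set v | v ^+ 2 == b * 4] finset.set0; last first.
  rewrite inE => /eqP vb _; have := bound 1 v (oner_neq0 _).
  by rewrite mul1r vb mulfK.
rewrite cards0 add0n => c2; have /card_gt0P[v] : (0 < #|[set v | g * v ^+ 2 == b * 4]%R|)%N by rewrite c2.
by rewrite inE => /eqP vb; have := bound g v g_neq0; rewrite vb mulfK.
Qed.

(** The substitution [s |-> b / s] reduces to [n = 1] at the cost of a sign. *)
Lemma salie_bound n b : b != 0 -> `|salie n b| ^+ 2 <= 9 * q ^+ 2.
Proof.
move=> b_neq0; have [eps eps2 epsE] := gauss_sum_sign b_neq0.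
have eps1 : `|eps| = 1.
  by apply/eqP; rewrite -(@pexpr_eq1 _ _ 2) ?normr_ge0 // -normrX eps2 normr1.
have -> : salie n b = eps * salie 1 (n * b).
  rewrite /salie mulr_sumr.
  have inv_inj : injective (fun s => b / s) by move=> s1 s2 /(mulfI b_neq0)/invr_inj.
  rewrite (reindex_inj inv_inj); apply: eq_big => [s|s].
    by rewrite mulf_eq0 invr_eq0 (negPf b_neq0).
  rewrite mulf_eq0 invr_eq0 (negPf b_neq0) /= => s_neq0.
  rewrite [RHS]mulrA gauss_sum_inv // epsE //; congr (_ * psi _).
  by field; rewrite s_neq0 b_neq0.
rewrite normrM eps1 mul1r (_ : 9 * q ^+ 2 = (3 * q) ^+ 2); last by ring.
by rewrite lerXn2r ?nnegrE ?normr_ge0 ?mulr_ge0 ?ler0n ?salie1_bound.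
Qed.

Hypothesis kloosterman_le : forall a b : F, a != 0 -> b != 0 ->
  kloosterman psi a b ^+ 2 <= 4 * q.

(** Up to scaling, the sum is the Fourier transform of a sphere at a frequency of norm [n]. For even
    [d] the weight [gauss_sum s ^- d] is constant and a Kloosterman sum remains; for odd [d] one
    factor [gauss_sum s] remains and gives a Salie sum. *)
Lemma sphere_transform_bound d (n b : F) : b != 0 ->
  q ^+ d * `|\sum_(s | s != 0) gauss_sum s ^- d * psi (n * s + b / s)| ^+ 2 <= 9 * q.
Proof.
move=> b_neq0.
have q_ge1 : 1 <= q by rewrite ler1n (ltn_trans _ (finRing_gt1 F)).
have G1 : gauss_sum 1 != 0 by rewrite gauss_sum_neq0 ?oner_neq0.
have GX k s : s != 0 -> gauss_sum s ^+ k.*2 = gauss_sum 1 ^+ k.*2.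
  by move=> s_neq0; rewrite -mul2n !exprM gauss_sum_sqr.
have GN k : `|gauss_sum 1 ^+ k| ^+ 2 = q ^+ k.
  by rewrite normrX -exprM mulnC exprM gauss_sum_sqr_norm ?oner_neq0.
have qX_neq0 k : q ^+ k != 0 by rewrite expf_neq0 // gt_eqF // (lt_le_trans ltr01).
have [d_odd|d_even] := boolP (odd d).
  have [k dk] : exists k, d.+1 = k.*2 by exists (d.+1)./2; lia.
  have -> : \sum_(s | s != 0) gauss_sum s ^- d * psi (n * s + b / s) =
      gauss_sum 1 ^- d.+1 * salie n b.
    rewrite /salie mulr_sumr; apply: eq_bigr => s s_neq0.
    rewrite mulrA dk -(GX _ _ s_neq0) -dk exprSr invfM; congr (_ * _).
    by rewrite divfK // gauss_sum_neq0.
  rewrite normrM exprMn normrV ?unitfE ?expf_neq0 // exprVn GN.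
  rewrite [q ^+ d.+1]exprSr invfM !mulrA mulfV // mul1r -mulrA -expr2.
  rewrite ler_pdivrMl ?(lt_le_trans ltr01) // mulrCA -expr2.
  exact: salie_bound.
have dk : d = d./2.*2 by lia.
have -> : \sum_(s | s != 0) gauss_sum s ^- d * psi (n * s + b / s) =
    gauss_sum 1 ^- d * kloosterman psi n b.
  rewrite /kloosterman mulr_sumr; apply: eq_bigr => s s_neq0.
  by rewrite dk GX.
rewrite normrM exprMn normrV ?unitfE ?expf_neq0 // exprVn GN mulrA mulfV // mul1r.
rewrite real_normK ?kloosterman_real //.
(* For [n = 0] the Kloosterman sum degenerates to [-1]. *)
have [->|n_neq0] := eqVneq n 0; last first.
  by apply: le_trans (kloosterman_le n_neq0 b_neq0) _; rewrite ler_wpM2r ?ler0n ?ler_nat.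
rewrite /kloosterman (reindex_inj invr_inj) /=.
under eq_bigl do rewrite invr_eq0.
under eq_bigr do rewrite mul0r add0r invrK.
rewrite sum_char_neq0 (negPf b_neq0) add0r sqrrN expr1n.
by apply: le_trans q_ge1 _; rewrite ler_peMl ?ler0n // ler1n.
Qed.

End GaussSums.

(** * Pairs of points at a given distance *)

Lemma sum_row_prod (F : finFieldType) (d : nat) (f : 'I_d -> F -> algC) :
  \sum_(x : 'rV[F]_d) \prod_i f i (x 0 i) = \prod_i \sum_y f i y.
Proof.
rewrite bigA_distr_bigA /= (reindex (fun g : {ffun 'I_d -> F} => \row_i g i)) /=.
  by apply: eq_bigr => g _; apply: eq_bigr => i _; rewrite mxE.
exists (fun x : 'rV_d => [ffun i => x 0 i]) => [g _|x _].
  by apply/ffunP => i; rewrite ffunE mxE.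
by apply/rowP => i; rewrite mxE ffunE.
Qed.

Section Mixing.
Variables (F : finFieldType) (psi : F -> algC).
Hypotheses (psi_char : additive_character psi) (two_neq0 : (2 : F) != 0).
Hypothesis kloosterman_le : forall a b : F, a != 0 -> b != 0 ->
  kloosterman psi a b ^+ 2 <= 4 * #|F|%:R.
Variable d : nat.

Local Notation q := (#|F|%:R : algC).

Let dot (x y : 'rV[F]_d) : F := \sum_i x 0 i * y 0 i.

Let dotBr x y z : dot x (y - z) = dot x y - dot x z.
Proof. by rewrite /dot -sumrB; apply: eq_bigr => i _; rewrite !mxE mulrBr. Qed.

Lemma sum_char_dot (z : 'rV[F]_d) :
  \sum_xi psi (dot xi z) = if z == 0 then q ^+ d else 0.
Proof.
under eq_bigr do rewrite (char_sum psi_char).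
rewrite (sum_row_prod (fun i y => psi (y * z 0 i))).
under eq_bigr do (under eq_bigr do rewrite mulrC; rewrite (sum_charM psi_char)).
case: eqVneq => [->|z_neq0].
  by under eq_bigr do rewrite mxE eqxx; rewrite prodr_const card_ord.
have [i zi] : exists i, z 0 i != 0.
  apply/existsP; apply: contraNT z_neq0; rewrite negb_exists => /forallP z0.
  by apply/eqP/rowP => i; rewrite mxE; apply/eqP/negPn.
by rewrite (bigD1 i) //= (negPf zi) mul0r.
Qed.

Lemma sum_char_gaussian (s : F) (z : 'rV[F]_d) : s != 0 ->
  \sum_xi psi (s * sqnorm xi + dot xi z) =
    gauss_sum psi s ^+ d * psi (- (sqnorm z / (4 * s))).
Proof.
move=> s_neq0.
under eq_bigr do rewrite /sqnorm mulr_sumr -big_split (char_sum psi_char) /=.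
rewrite (sum_row_prod (fun i y => psi (s * y ^+ 2 + y * z 0 i))).
under eq_bigr do rewrite (sum_quadratic_char psi_char) //.
rewrite big_split /= prodr_const card_ord -(char_sum psi_char).
by rewrite sumrN mulr_suml.
Qed.

Let hat (A : {set 'rV[F]_d}) xi : algC := \sum_(x in A) psi (dot xi x).

Lemma plancherel (A : {set 'rV[F]_d}) :
  \sum_xi `|\sum_(x in A) psi (dot xi x)| ^+ 2 = q ^+ d * #|A|%:R.
Proof.
under eq_bigr do rewrite normCK rmorph_sum big_distrlr /=.
rewrite exchange_big /= mulr_natr -sumr_const; apply: eq_bigr => x xA.
rewrite exchange_big /= (bigD1 x) //= [X in _ + X]big1 ?addr0 => [|y /andP[_ yx]].
  under eq_bigr do rewrite (char_conj psi_char) (charN psi_char).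
  by rewrite sumr_const card_mx mul1n natrX.
under eq_bigr do rewrite (char_conj psi_char) -(charD psi_char) -dotBr.
by rewrite sum_char_dot subr_eq0 eq_sym (negPf yx).
Qed.

Definition distance_pairs (t : F) (A B : {set 'rV[F]_d}) : nat :=
  (\sum_(x in A) \sum_(y in B) (sqnorm (x - y) == t)%R)%N.

(** The centred count expands over frequencies [xi] into products of the transforms of [A], [B] and
    the sphere. The last is bounded uniformly in [xi], and Cauchy-Schwarz with [plancherel] handles
    the other two. *)
Lemma mixing_algC (t : F) (A B : {set 'rV[F]_d}) : t != 0 ->
  (q * (distance_pairs t A B)%:R - #|A|%:R * #|B|%:R) ^+ 2 <=
    9 * q ^+ d.+1 * (#|A|%:R * #|B|%:R).
Proof.
move=> t_neq0.
have four_neq0 : (4 : F) != 0 by rewrite (_ : 4 = 2 * 2) ?mulf_neq0 // -natrM.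
have q_gt0 : 0 < q by rewrite ltr0n (ltn_trans _ (finRing_gt1 F)).
pose I (xi : 'rV[F]_d) : algC := \sum_(s | s != 0) gauss_sum psi s ^- d * psi (sqnorm xi * s + t / 4 / s).
pose cB (xi : 'rV[F]_d) : algC := \sum_(y in B) psi (- dot xi y).
have cBE xi : `|cB xi| = `|\sum_(y in B) psi (dot xi y)|.
  rewrite -[RHS]norm_conjC rmorph_sum /=; congr (`|_|).
  by apply: eq_bigr => y _; rewrite (char_conj psi_char).
have mainE : q * (distance_pairs t A B)%:R - #|A|%:R * #|B|%:R =
    \sum_xi hat A xi * cB xi * I xi.
  have xyE x y : q * (sqnorm (x - y) == t)%:R - 1 =
      \sum_xi psi (dot xi x) * psi (- dot xi y) * I xi.
    transitivity (\sum_(s | s != 0) psi (s * (sqnorm (x - y) - t))).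
      under eq_bigr do rewrite mulrC.
      rewrite (sum_char_neq0 psi_char) subr_eq0; congr (_ - 1).
      by case: eqP; rewrite ?mulr1 ?mulr0.
    under [RHS]eq_bigr do rewrite mulr_sumr.
    rewrite [RHS]exchange_big /=.
    (* This substitution creates the phase [- sqnorm z / (4 * s)] of [sum_char_gaussian], which is
       then read from right to left. *)
    have s_inj : injective (fun s : F => - (4 * s)^-1).
      by move=> s1 s2 /oppr_inj/invr_inj/(mulfI four_neq0).
    rewrite (reindex_inj s_inj); apply: eq_big => [s|s].
      by rewrite oppr_eq0 invr_eq0 mulf_eq0 (negPf four_neq0).
    rewrite oppr_eq0 invr_eq0 mulf_eq0 (negPf four_neq0) /= => s_neq0.
    transitivity (psi (t / 4 / s) * gauss_sum psi s ^- d *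
        \sum_xi psi (s * sqnorm xi + dot xi (x - y))).
      rewrite sum_char_gaussian // !mulrA mulfVK; last first.
        by rewrite expf_neq0 // gauss_sum_neq0.
      by rewrite -(charD psi_char); congr psi; field; rewrite four_neq0 s_neq0.
    rewrite mulr_sumr; apply: eq_bigr => xi _.
    rewrite dotBr (charD psi_char) (charD psi_char (dot _ _)) (charD psi_char (_ * s)).
    by rewrite (mulrC s); ring.
  transitivity (\sum_(x in A) \sum_(y in B) (q * (sqnorm (x - y) == t)%:R - 1)).
    under eq_bigr do rewrite sumrB sumr_const -mulr_sumr.
    rewrite sumrB sumr_const -mulr_sumr -mulr_natl; congr (_ * _ - _); last first.
      by rewrite mulr_natl.
    by rewrite natr_sum; apply: eq_bigr => x _; rewrite natr_sum.
  rewrite (eq_bigr (fun x => \sum_xi \sum_(y in B)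
      psi (dot xi x) * psi (- dot xi y) * I xi)) => [|x _]; last first.
    by rewrite exchange_big; apply: eq_bigr => y _; exact: xyE.
  rewrite exchange_big; apply: eq_bigr => xi _ /=.
  rewrite /hat /cB big_distrlr /= mulr_suml; apply: eq_bigr => x _.
  by rewrite mulr_suml.
have realL : q * (distance_pairs t A B)%:R - #|A|%:R * #|B|%:R \is Num.real.
  by rewrite rpredB ?rpredM ?realn.
rewrite -(real_normK realL) mainE.
apply: (@le_trans _ _ ((\sum_xi (`|hat A xi| * `|I xi|) * `|cB xi|) ^+ 2)).
  apply: lerXn2r; first by rewrite nnegrE.
    by rewrite nnegrE; apply: sumr_ge0 => xi _; rewrite !mulr_ge0.
  apply: le_trans (ler_norm_sum _ _ _) _; apply: ler_sum => xi _.
  by rewrite !normrM mulrAC.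
apply: le_trans (sum_mul_sqr_le _ _) _ => [xi|xi|]; rewrite ?rpredM ?normr_real //.
have -> : \sum_xi `|cB xi| ^+ 2 = q ^+ d * #|B|%:R.
  by rewrite -plancherel; apply: eq_bigr => xi _; rewrite cBE.
have bI : q ^+ d * \sum_xi (`|hat A xi| * `|I xi|) ^+ 2 <= 9 * q * (q ^+ d * #|A|%:R).
  rewrite -plancherel !mulr_sumr; apply: ler_sum => xi _.
  rewrite exprMn mulrCA mulrC ler_wpM2r ?exprn_ge0 //.
  by apply: sphere_transform_bound => //; rewrite mulf_neq0 ?invr_eq0.
rewrite mulrCA mulrA.
have -> : 9 * q ^+ d.+1 * (#|A|%:R * #|B|%:R) =
          9 * q * (q ^+ d * #|A|%:R) * #|B|%:R by rewrite exprS; ring.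
by rewrite ler_wpM2r ?ler0n.
Qed.

End Mixing.

(** Both sides are images of integers, so the inequality passes from [algC] to any [R]. *)
Theorem distance_pairs_mixing (R : numDomainType) (p n d : nat) (F : finFieldType)
    (t : F) (A B : {set 'rV[F]_d}) :
    prime p -> odd p -> (0 < n)%N -> #|F| = (p ^ n)%N -> t != 0 ->
  (#|F|%:R * (distance_pairs t A B)%:R - #|A|%:R * #|B|%:R) ^+ 2 <=
    9 * #|F|%:R ^+ d.+1 * (#|A|%:R * #|B|%:R) :> R.
Proof.
move=> p_pr p_odd n_gt0 F_card t_neq0.
have [zeta zeta_prim] := C_prim_root_exists (prime_gt0 p_pr).
have K_le (a b : F) : a != 0 -> b != 0 ->
    kloosterman (trace_char p n zeta (L := F)) a b ^+ 2 <= 4 * #|F|%:R.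
  by move=> *; apply: kloosterman_bound.
have := mixing_algC (trace_char_additive p_pr F_card zeta_prim n_gt0)
  (two_neq0_odd p_pr p_odd F_card) K_le A B t_neq0.
pose lhs : int := (#|F|%:Z * (distance_pairs t A B)%:Z - #|A|%:Z * #|B|%:Z) ^+ 2.
pose rhs : int := 9%:Z * #|F|%:Z ^+ d.+1 * (#|A|%:Z * #|B|%:Z).
have lhsE (S : numDomainType) :
    (#|F|%:R * (distance_pairs t A B)%:R - #|A|%:R * #|B|%:R) ^+ 2 = lhs%:~R :> S.
  by rewrite rmorphXn rmorphB !rmorphM.
have rhsE (S : numDomainType) :
    9 * #|F|%:R ^+ d.+1 * (#|A|%:R * #|B|%:R) = rhs%:~R :> S.
  by rewrite !rmorphM rmorphXn.
by rewrite !lhsE !rhsE !ler_int.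
Qed.

(** * Cycles in distance graphs *)

Lemma contains_cycle_graph (G : sgraph) n (s : n.-tuple G) :
  uniq s -> cycle (@sedge G) s -> contains_copy G (cycle_graph n).
Proof.
move=> s_uniq s_cycle.
have s_edge (i : 'I_n) : sedge (tnth s i) (tnth s (ordS i)).
  case: n s i s_uniq s_cycle => [|n] s i; first by case: i.
  case: (tupleP s) => x s' _ /=; move/(pathP x) => /(_ i).
  rewrite !(tnth_nth x) /= size_rcons size_tuple => /(_ (ltn_ord i)).
  rewrite nth_rcons size_tuple.
  have -> : nth x (x :: rcons s' x) i = nth x (x :: s') i.
    case: (nat_of_ord i) (ltn_ord i) => //= j; rewrite ltnS => jn.
    by rewrite nth_rcons size_tuple jn.
  have := ltn_ord i; rewrite ltnS leq_eqVlt => /orP[/eqP ->|i_lt].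
    by rewrite ltnn eqxx modnn.
  by rewrite i_lt modn_small.
have cycle_edge (i j : 'I_n) : cycle_rel i j -> sedge (tnth s i) (tnth s j).
  by case/andP=> _ /orP[] /eqP ->; [exact: s_edge | rewrite sedge_sym; exact: s_edge].
(* Only edges between cyclic neighbours are kept, since [G] may also contain chords of the cycle. *)
pose edge (x y : G) := [exists i, exists j,
  [&& x == tnth s i, y == tnth s j & cycle_rel i j]].
have edge_sym : symmetric edge.
  move=> x y; apply/existsP/existsP => -[i /existsP[j /and3P[xi yj ij]]];
    by exists j; apply/existsP; exists i; rewrite xi yj cycle_rel_sym.
have edge_incl x y : edge x y -> [&& x \in [set x in s], y \in [set x in s] & sedge x y].
  case/existsP=> i /existsP[j /and3P[/eqP -> /eqP -> ij]].
  by rewrite !inE !mem_tnth cycle_edge.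
exists (Subgraph edge_sym edge_incl).
have idx_lt (x : {x : G | x \in [set x in s]}) : (index (val x) s < n)%N.
  by have := valP x; rewrite inE -index_mem size_tuple.
have tnth_s (i : 'I_n) : tnth s i \in [set x in s] by rewrite inE mem_tnth.
have tnthK (x : {x : G | x \in [set x in s]}) : tnth s (Ordinal (idx_lt x)) = val x.
  by rewrite (tnth_nth (val x)) nth_index //; have := valP x; rewrite inE.
have s_inj : injective (tnth s) by apply/tuple_uniqP.
exists (fun x : {x : G | x \in [set x in s]} => Ordinal (idx_lt x)); split.
  exists (fun i => exist _ (tnth s i) (tnth_s i)) => [x|i].
    by apply: val_inj; rewrite /= tnthK.
  by apply: s_inj; rewrite tnthK.
move=> x y; rewrite /sedge /= /subgraph_rel /=.
apply/idP/existsP => [xy|[i /existsP[j /and3P[/eqP xi /eqP yj ij]]]].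
  exists (Ordinal (idx_lt x)); apply/existsP; exists (Ordinal (idx_lt y)).
  by rewrite !tnthK !eqxx.
have -> : Ordinal (idx_lt x) = i by apply: s_inj; rewrite tnthK.
by have -> : Ordinal (idx_lt y) = j by apply: s_inj; rewrite tnthK.
Qed.

Lemma even_cycle_distance_graph (R : realFieldType) (F : finFieldType) (d k : nat)
    (t : F) (E : {set 'rV[F]_d}) :
    t != 0 ->
    (forall A B : {set 'rV[F]_d},
      (#|F|%:R * (distance_pairs t A B)%:R - #|A|%:R * #|B|%:R) ^+ 2 <=
        9 * #|F|%:R ^+ d.+1 * (#|A|%:R * #|B|%:R) :> R) ->
    (1 < k)%N -> (2 * k <= d.+1 * k.-1)%N ->
    ((32 * k ^ 2) ^ 2)%:R ^+ 2 * #|F|%:R ^+ d.+1 < #|E|%:R ^+ 2 :> R ->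
  contains_copy (distance_graph t E) (cycle_graph (2 * k)).
Proof.
move=> t_neq0 mix k_gt1 dk.
have k_le : (k * 2 <= 2 * 2 * k.-1)%N by lia.
move=> En.
set q : R := #|F|%:R in mix En *.
set n : R := #|E|%:R in En *.
have q_gt0 : 0 < q by rewrite ltr0n (ltn_trans _ (finRing_gt1 F)).
have n_gt0 : 0 < n.
  rewrite lt_neqAle ler0n andbT; apply/eqP => n0; move: En.
  by rewrite -n0 expr0n /= ltNge mulr_ge0 ?exprn_ge0 ?ler0n.
(* It is enough that the constant is at least 12, as [12 ^ 2 = 9 * 16]. *)
have Q_le : 9 * q ^+ d.+1 <= n ^+ 2 / 16.
  have c_ge : 12 <= ((32 * k ^ 2) ^ 2)%:R :> R.
    have k2_gt0 : (0 < k ^ 2)%N by rewrite expn_gt0 ltnW.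
    rewrite ler_nat -[((32 * k ^ 2) ^ 2)%N]mulnn; move: (k ^ 2)%N k2_gt0 => x; nia.
  move: En; set c : R := ((32 * k ^ 2) ^ 2)%:R in c_ge * => En.
  have Q_ge0 : 0 <= q ^+ d.+1 by rewrite exprn_ge0 ?ltW.
  have c2_ge : 144 <= c ^+ 2 by nra.
  have := ler_wpM2r Q_ge0 c2_ge; move: (c ^+ 2 * _) En => z En zge; lra.
pose deg (X : {set 'rV[F]_d}) x : nat := (\sum_(y in X) (sqnorm (x - y) == t)%R)%N.
pose H := [set x in E | 2 * n < q * (deg E x)%:R].
pose E' := E :\: H.
(* Points of [H] have more than twice the expected degree [n / q], so the deviation for the pair
   [H], [E] is at least [#|H| * n], and mixing forces [H] to be small. *)
have H_le : #|H|%:R <= n / 16.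
  have := mix H E; rewrite -/n; set h : R := #|H|%:R.
  have dp_ge : 2 * n * h <= q * (distance_pairs t H E)%:R.
    rewrite /h [leLHS]mulr_natr -sumr_const natr_sum mulr_sumr; apply: ler_sum => x.
    by rewrite inE => /andP[_ deg_gt]; exact: ltW.
  have h_ge0 : 0 <= h by rewrite ler0n.
  move: (q * _) dp_ge => dp dp_ge dp_le.
  have hn_ge0 : 0 <= h * n by rewrite mulr_ge0 ?(ltW n_gt0).
  have hn_le : (h * n) ^+ 2 <= n ^+ 2 / 16 * (h * n).
    apply: le_trans (le_trans dp_le _); last by rewrite ler_wpM2r.
    by rewrite lerXn2r ?nnegrE //; lra.
  have [->|h_neq0] := eqVneq h 0; first by rewrite divr_ge0 ?ltW.
  have hn_gt0 : 0 < h * n by rewrite mulr_gt0 // lt_neqAle eq_sym h_neq0.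
  have : h * n <= n / 16 * n.
    by rewrite -(ler_pM2r hn_gt0) -expr2 (_ : n / 16 * n = n ^+ 2 / 16) //; ring.
  by rewrite ler_pM2r.
have HE : H \subset E by apply/fintype.subsetP => x; rewrite inE => /andP[].
have E'E : E' \subset E by exact: finset.subsetDl.
have E'_ge : 15 / 16 * n <= #|E'|%:R.
  rewrite /E' cardsD (finset.setIidPr HE) natrB ?subset_leq_card // -/n; lra.
have E'_le : #|E'|%:R <= n by rewrite ler_nat subset_leq_card.
(* The deviation for [E'] with itself is at most [n * n' / 4], and [n' >= 15/16 n] leaves [q] times
   the count at least [11/16 n * n']. *)
have pairs_ge : #|E'|%:R * (n / (2 * q)) <= (distance_pairs t E' E')%:R.
  have mixE := mix E' E'; set n' : R := #|E'|%:R in mixE E'_ge E'_le *.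
  rewrite mulrA ler_pdivrMr ?mulr_gt0 // [leRHS]mulrC -mulrA.
  move: (q * _) mixE => dp dp_le.
  have n'_ge0 : 0 <= n' by rewrite ler0n.
  have : `|dp - n' * n'| <= n * n' / 4.
    rewrite -(@ler_pXn2r _ 2) ?nnegrE ?normr_ge0 ?divr_ge0 ?mulr_ge0 ?(ltW n_gt0) //.
    rewrite real_normK ?num_real //; apply: le_trans dp_le _.
    rewrite (_ : (n * n' / 4) ^+ 2 = n ^+ 2 / 16 * (n' * n')) ?ler_wpM2r ?mulr_ge0 //.
    by field.
  rewrite ler_norml => /andP[dp_ge _].
  have diff_ge0 : 0 <= (n' - 15 / 16 * n) * n' by rewrite mulr_ge0 // subr_ge0.
  have nn'_ge0 : 0 <= n * n' by rewrite mulr_ge0 // ltW.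
  lra.
pose V : finType := {x : 'rV[F]_d | x \in E'}.
pose e : rel V := fun x y => sqnorm (val x - val y) == t.
have e_sym : symmetric e.
  move=> x y; rewrite /e; congr (_ == t).
  by apply: eq_bigr => i _; rewrite -opprB mxE sqrrN.
have e_irr : irreflexive e.
  move=> x; rewrite /e subrr /sqnorm big1 => [|i _]; last by rewrite mxE expr0n.
  by rewrite eq_sym (negPf t_neq0).
have V_card : #|V|%:R = #|E'|%:R :> R by rewrite card_sig; congr _%:R; apply: eq_card.
have degE (x : V) : degree R e x = (deg E' (val x))%:R.
  by rewrite natr_sum big_sub.
have Delta_ge (x : V) : degree R e x <= 2 * n / q.
  rewrite degE ler_pdivlMr // mulrC.
  have := valP x; rewrite inE inE => /andP[xH xE]; move: xH.
  rewrite xE /= -leNgt; apply: le_trans; rewrite ler_wpM2l ?(ltW q_gt0) // ler_nat.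
  rewrite /deg [leqRHS](big_setID E') /= (finset.setIidPr E'E).
  exact: leq_addr.
have avg_ge : #|V|%:R * (n / (2 * q)) <= \sum_x degree R e x.
  rewrite V_card; apply: le_trans pairs_ge _.
  by rewrite natr_sum big_sub; apply: ler_sum => x _; rewrite degE.
have V_gt0 : (0 < #|V|)%N.
  by rewrite -(ltr0n R) V_card; apply: lt_le_trans E'_ge; rewrite mulr_gt0 ?divr_gt0.
have D_ge0 : 0 <= n / (2 * q) by rewrite divr_ge0 ?mulr_ge0 ?ltW.
(* With [D = n / (2 q)], [Delta = 2 n / q] and [K = 32 k^2], a common factor [(n / (4 q)) ^+ k]
   cancels, and the condition reads [(K q)^k #|V| < n^k]. *)
have dense : ((k.*2 ^ 2)%:R * (2 * n / q)) ^+ k * #|V|%:R < (n / (2 * q)) ^+ k.*2.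
  have [K KE] : exists K : R, K = (32 * k ^ 2)%:R by eexists.
  have K_ge1 : 1 <= K by rewrite KE ler1n muln_gt0 expn_gt0 (ltnW k_gt1).
  (* After squaring, compare with the power [k.-1] of the size hypothesis: the exponents of [K]
     satisfy [2 k <= 4 (k - 1)] by [k_le], those of [q] satisfy [2 k <= (d + 1) (k - 1)] by [dk]. *)
  have key : (K * q) ^+ k < n ^+ k.-1.
    have K_ge0 : 0 <= K by exact: le_trans ler01 K_ge1.
    have Kq_ge0 : 0 <= K * q by rewrite mulr_ge0 // ltW.
    rewrite -(@ltr_pXn2r _ 2) ?nnegrE ?exprn_ge0 ?(ltW n_gt0) // -!exprM.
    rewrite [in ltRHS]mulnC [in ltRHS]exprM.
    apply: (@le_lt_trans _ _ ((((32 * k ^ 2) ^ 2)%:R ^+ 2 * q ^+ d.+1) ^+ k.-1)).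
      rewrite natrX -KE [leLHS]exprMn [leRHS]exprMn -!exprM.
      apply: ler_pM; rewrite ?exprn_ge0 ?(ltW q_gt0) //.
        exact: (ler_weXn2l K_ge1).
      by rewrite ler_weXn2l ?ler1n ?(ltn_trans _ (finRing_gt1 F)) // mulnC.
    rewrite ltrXn2r ?nnegrE ?mulr_ge0 ?exprn_ge0 ?ler0n ?(ltW q_gt0) //.
    by rewrite -lt0n -ltnS prednK // ltnW.
  rewrite V_card.
  have -> : (k.*2 ^ 2)%:R * (2 * n / q) = (n / (4 * q)) * K.
    by rewrite KE -muln2 expnMn !natrM; field; rewrite gt_eqF.
  have -> : (n / (2 * q)) ^+ k.*2 = (n / (4 * q)) ^+ k * (n / q) ^+ k.
    by rewrite -mul2n exprM -exprMn; congr (_ ^+ _); field; rewrite gt_eqF.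
  rewrite exprMn -mulrA ltr_pM2l; last by rewrite exprn_gt0 // divr_gt0 // mulr_gt0.
  rewrite expr_div_n ltr_pdivlMr ?exprn_gt0 // mulrAC -exprMn.
  apply: (@le_lt_trans _ _ ((K * q) ^+ k * n)).
    by rewrite ler_wpM2l // exprn_ge0 // mulr_ge0 ?(ltW q_gt0) // (le_trans ler01).
  by rewrite -[in ltRHS](prednK (ltnW k_gt1)) exprSr ltr_pM2r.
have [s /andP[s_uniq s_cycle]] :=
  even_cycle_of_dense e_sym e_irr V_gt0 D_ge0 Delta_ge avg_ge k_gt1 dense.
have inclP (x : V) : val x \in E by apply: (fintype.subsetP E'E); exact: valP.
pose incl (x : V) : distance_graph t E := exist _ (val x) (inclP x).
rewrite mul2n; apply: (@contains_cycle_graph _ _ (map_tuple incl s)).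
  by rewrite map_inj_uniq // => x y /(congr1 val) /= /val_inj.
apply: homo_cycle s_cycle => x y exy; apply/andP; split; last exact: exy.
by apply: contraTneq exy => /(congr1 val) /= /val_inj ->; rewrite e_irr.
Qed.

Theorem corollary1p11 (R : realType) (k : nat) (hk : (2 <= k)%N) :
  exists c : R, 0 < c /\
    forall (p m : nat), prime p -> odd p -> (0 < m)%N ->
    forall (F : finFieldType), #|F| = (p ^ m)%N ->
    forall (d : nat) (E : {set 'rV[F]_d}),
      c * ((p ^ m)%:R `^ ((d%:R + 1) / 2)) < #|E|%:R ->
      (d = 2%N -> (3 <= k)%N ->
        ([set: F] `\ (0 : F) `<=` graph_distance_set (cycle_graph (2 * k)) E)%classic)
      /\
      ((3 <= d)%N ->
        ([set: F] `\ (0 : F) `<=` graph_distance_set (cycle_graph (2 * k)) E)%classic).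
Proof.
exists ((32 * k ^ 2) ^ 2)%:R; split; first by rewrite ltr0n expn_gt0 muln_gt0 expn_gt0; lia.
move=> p m p_pr p_odd m_gt0 F F_card d E En.
suff main : (2 * k <= d.+1 * k.-1)%N ->
    ([set: F] `\ (0 : F) `<=` graph_distance_set (cycle_graph (2 * k)) E)%classic.
  (* For [d = 2] the condition is [2 k <= 3 (k - 1)], that is [k >= 3]; for [d >= 3] it follows from
     [2 k <= 4 (k - 1)]. *)
  by split=> [d2 k3|d3]; apply: main; [rewrite d2; lia | nia].
move=> dk t [_ /= /eqP t_neq0].
apply: (@even_cycle_distance_graph R) => // [A B|].
  exact: distance_pairs_mixing p_pr p_odd m_gt0 F_card t_neq0.
set c := _%:R in En *; set X := _ `^ _ in En.
(* Squaring turns the half-integral real exponent into the natural exponent of the mixing bound. *)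
have X2 : X ^+ 2 = #|F|%:R ^+ d.+1.
  rewrite F_card -powR_mulrn ?powR_ge0 // -powRrM -powR_mulrn //; congr (_ `^ _).
  by rewrite -[RHS]natr1 divfK // pnatr_eq0.
rewrite -X2 -exprMn ltrXn2r ?nnegrE ?mulr_ge0 ?powR_ge0 ?ler0n //.
Qed.
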